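(* Let $N,k\ge1$ and $p\ge0$ be integers and $L=kN+p$. Let $(\eta^{ij})$ ($N\times N$), $(c^{\sigma\tau})$ ($k\times k$), $(\mu^{\alpha\beta})$ ($L\times L$) be any constant nondegenerate symmetric real matrices with $\mu^{(\sigma-1)N+m,\,(\tau-1)N+n}=c^{\sigma\tau}\eta^{mn}$ for $1\le\sigma,\tau\le k$, $1\le m,n\le N$. Let $\mathbb{E}$ be a pseudo-Euclidean space of dimension $N+L=(k+1)N+p$ whose signature is the sum of the signatures of $(\eta_{ij})=(\eta^{ij})^{-1}$ and $(\mu_{\alpha\beta})=(\mu^{\alpha\beta})^{-1}$. Let $\Phi$ be a smooth solution, near a point $u_0\in\mathbb{R}^N$, of the associativity equations $$\sum_{a,b=1}^N\frac{\partial^3\Phi}{\partial u^i\partial u^j\partial u^a}\eta^{ab}\frac{\partial^3\Phi}{\partial u^b\partial u^m\partial u^n}=\sum_{a,b=1}^N\frac{\partial^3\Phi}{\partial u^i\partial u^m\partial u^a}\eta^{ab}\frac{\partial^3\Phi}{\partial u^b\partial u^j\partial u^n},\qquad 1\le i,j,m,n\le N.$$ Then locally near $u_0$ there exists a unique, up to motions of $\mathbb{E}$, totally nonisotropic $N$-dimensional flat torsionless submanifold $r(u)$ in $\mathbb{E}$ with normal basis $n_1(u),\dots,n_L(u)$ such that: the first fundamental form is $\eta_{ij}\,du^i\,du^j$; the Gram matrix of the normal basis is $\mu_{\alpha\beta}$; and the second fundamental forms are $$\omega_{(\sigma-1)N+m,\,ij}=\frac{\partial^3\Phi}{\partial u^m\partial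 u^i\partial u^j}\quad(1\le\sigma\le k,\ 1\le i,j,m\le N),\qquad \omega_{\alpha ij}=0\quad(kN+1\le\alpha\le L).$$
   Context: A submanifold given by an immersion $r:U\to\mathbb{E}$, $U\subset\mathbb{R}^N$ open, is totally nonisotropic if its first fundamental form $(\partial_ir,\partial_jr)$ is nondegenerate, where $(\cdot,\cdot)$ is the scalar product of $\mathbb{E}$. For a smooth basis $n_1,\dots,n_L$ of the normal spaces, the Gram matrix is $(n_\alpha,n_\beta)$, the second fundamental forms are $\omega_{\alpha ij}=(\partial_i\partial_jr,n_\alpha)$, and the torsion coefficients are $(\partial_in_\alpha,n_\beta)$. ''Torsionless'' means that all torsion coefficients vanish for the chosen normal basis; ''flat'' means that the first fundamental form is a flat metric. A motion of $\mathbb{E}$ is an affine isometry. ''Locally, unique up to motions'' means: such $(r,n_1,\dots,n_L)$ exists on some neighbourhood of $u_0$, and any two such tuples on the same connected neighbourhood of $u_0$ are carried to one another by a motion of $\mathbb{E}$ (its linear part acting on the $n_\alpha$). *)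

(* Defs.v *)
From HB Require Import structures.
From mathcomp Require Import all_boot all_order all_algebra.
From mathcomp Require Import all_classical all_reals all_analysis.

Set Implicit Arguments.
Unset Strict Implicit.
Unset Printing Implicit Defensive.

Import Order.TTheory GRing.Theory Num.Theory.
Import numFieldNormedType.Exports.

Local Open Scope classical_set_scope.
Local Open Scope ring_scope.

(* [partials [:: i; j; l] f] is d_i (d_j (d_l f)). *)
Definition partial (R : realType) (N : nat) (V : normedModType R) (i : 'I_N)
    (f : 'rV[R]_N -> V) : 'rV[R]_N -> V :=
  fun u => derive f u (delta_mx 0 i).

Definition partials (R : realType) (N : nat) (V : normedModType R)
    (s : seq 'I_N) (f : 'rV[R]_N -> V) : 'rV[R]_N -> V :=
  foldr (fun i g => partial i g) f s.

(* C^infinity: partial derivatives of all orders exist and are continuous on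
   the (open) set U; outside U the values of f are irrelevant. *)
Definition smooth_on (R : realType) (N : nat) (V : normedModType R)
    (U : set 'rV[R]_N) (f : 'rV[R]_N -> V) : Prop :=
  forall (s : seq 'I_N) (u : 'rV[R]_N), U u ->
    {for u, continuous (partials s f)} /\
    (forall i : 'I_N, derivable (partials s f) u (delta_mx 0 i)).

Definition nondegenerate_symmetric (R : realType) (n : nat) (A : 'M[R]_n)
    : Prop :=
  A^T = A /\ A \in unitmx.

(* The form with matrix A has signature (a, b): in some basis it is diagonal
   with a positive and b negative entries. By Sylvester's law of inertia, (a, b)
   exists and is unique for every symmetric A. *)
Definition has_signature (R : realType) (n : nat) (A : 'M[R]_n) (a b : nat)
    : Prop :=
  exists (P : 'M[R]_n) (d : 'rV[R]_n),
    [/\ P \in unitmx, P *m A *m P^T = diag_mx d,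
        #|[set i : 'I_n | 0 < d 0 i]%SET| = a &
        #|[set i : 'I_n | d 0 i < 0]%SET| = b].

(* A pseudo-Euclidean space is R^D with the scalar product of an arbitrary
   nondegenerate symmetric Gram matrix G. *)
Definition dot (R : realType) (D : nat) (G : 'M[R]_D) (x y : 'rV[R]_D) : R :=
  (x *m G *m y^T) 0 0.

(* Linear part of a motion; x |-> x *m A + b is then the motion itself. *)
Definition linear_isometry (R : realType) (D : nat) (G A : 'M[R]_D) : Prop :=
  forall x y : 'rV[R]_D, dot G (x *m A) (y *m A) = dot G x y.

Section RiemannCurvature.
Variables (R : realType) (N : nat) (g : 'rV[R]_N -> 'M[R]_N).

(* Gamma^l_{ij} of the Levi-Civita connection of g. *)
Definition christoffel (l i j : 'I_N) (u : 'rV[R]_N) : R :=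
  2%:R^-1 * \sum_(a < N) invmx (g u) l a *
    (partial i (fun v => g v j a) u + partial j (fun v => g v i a) u
     - partial a (fun v => g v i j) u).

(* R^l_{mij}. *)
Definition riemann (l m i j : 'I_N) (u : 'rV[R]_N) : R :=
  partial i (christoffel l j m) u - partial j (christoffel l i m) u
  + \sum_(a < N) (christoffel l i a u * christoffel a j m u
                  - christoffel l j a u * christoffel a i m u).

Definition flat_metric_on (U : set 'rV[R]_N) : Prop :=
  forall u, U u -> forall l m i j, riemann l m i j u = 0.

End RiemannCurvature.

Section Submanifold.
Variables (R : realType) (N D L : nat) (G : 'M[R]_D).
Variables (U : set 'rV[R]_N).
Variables (r : 'rV[R]_N -> 'rV[R]_D) (n : 'I_L -> 'rV[R]_N -> 'rV[R]_D).

Definition first_form (u : 'rV[R]_N) : 'M[R]_N :=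
  \matrix_(i, j) dot G (partial i r u) (partial j r u).

Definition normal_gram (u : 'rV[R]_N) : 'M[R]_L :=
  \matrix_(al, be) dot G (n al u) (n be u).

Definition second_form (al : 'I_L) (u : 'rV[R]_N) : 'M[R]_N :=
  \matrix_(i, j) dot G (partials [:: i; j] r u) (n al u).

Definition torsion (i : 'I_N) (al be : 'I_L) (u : 'rV[R]_N) : R :=
  dot G (partial i (n al) u) (n be u).

Definition immersion_on : Prop :=
  smooth_on U r /\
  forall u, U u -> row_free (\matrix_(i < N) partial i r u : 'M[R]_(N, D)).

Definition totally_nonisotropic_on : Prop :=
  forall u, U u -> first_form u \in unitmx.

Definition is_normal_vector (u : 'rV[R]_N) (v : 'rV[R]_D) : Prop :=
  forall i : 'I_N, dot G v (partial i r u) = 0.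

Definition normal_basis_on : Prop :=
  (forall al, smooth_on U (n al)) /\
  forall u, U u ->
    let B := \matrix_(al < L) n al u : 'M[R]_(L, D) in
    row_free B /\ forall v, (v <= B)%MS <-> is_normal_vector u v.

Record flat_torsionless_submanifold : Prop := FlatTorsionlessSubmanifold {
  fts_immersion : immersion_on;
  fts_nonisotropic : totally_nonisotropic_on;
  fts_flat : flat_metric_on first_form U;
  fts_normal_basis : normal_basis_on;
  fts_torsionless : forall u, U u -> forall i al be, torsion i al be u = 0
}.

End Submanifold.

Definition associativity_on (R : realType) (N : nat) (eta : 'M[R]_N)
    (U : set 'rV[R]_N) (Phi : 'rV[R]_N -> R) : Prop :=
  forall u, U u -> forall i j m n : 'I_N,
    \sum_(a < N) \sum_(b < N) partials [:: i; j; a] Phi u * eta a b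
                              * partials [:: b; m; n] Phi u
  = \sum_(a < N) \sum_(b < N) partials [:: i; m; a] Phi u * eta a b
                              * partials [:: b; j; n] Phi u.

Lemma block_index_subproof (N k p : nat) (s : 'I_k) (m : 'I_N) :
  (s * N + m < k * N + p)%N.
Proof.
apply: (@leq_trans (k * N)); last exact: leq_addr.
apply: (@leq_trans (s * N + N)); first by rewrite ltn_add2l.
by rewrite addnC -mulSn leq_mul2r ltn_ord orbT.
Qed.

(* Indices start at 0: this is the index (sigma-1)N+m of the 1-based count. *)
Definition block_index (N k p : nat) (s : 'I_k) (m : 'I_N) : 'I_(k * N + p) :=
  Ordinal (block_index_subproof p s m).

(* The data (eta_ij), (mu_al_be) and the second fundamental forms prescribed by
   the potential Phi; eta and mu carry upper indices. *)
Record prescribed_by_potential (R : realType) (N k p D : nat) (G : 'M[R]_D)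
    (eta : 'M[R]_N) (mu : 'M[R]_(k * N + p)) (Phi : 'rV[R]_N -> R)
    (U : set 'rV[R]_N) (r : 'rV[R]_N -> 'rV[R]_D)
    (n : 'I_(k * N + p) -> 'rV[R]_N -> 'rV[R]_D) : Prop :=
  PrescribedByPotential {
  pbp_submanifold : flat_torsionless_submanifold G U r n;
  pbp_first_form : forall u, U u -> first_form G r u = invmx eta;
  pbp_gram : forall u, U u -> normal_gram G n u = invmx mu;
  pbp_second_form : forall u, U u -> forall (s : 'I_k) (m i j : 'I_N),
    second_form G r n (block_index p s m) u i j
      = partials [:: m; i; j] Phi u;
  pbp_second_form0 : forall u, U u -> forall al : 'I_(k * N + p),
    (k * N <= al)%N -> forall i j : 'I_N, second_form G r n al u i j = 0
}.

(* Main.v *)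
Require Import Defs.
From HB Require Import structures.
From mathcomp Require Import all_boot all_order all_algebra.
From mathcomp Require Import all_classical all_reals all_analysis.
From mathcomp Require Import ring lra.

Set Implicit Arguments.
Unset Strict Implicit.
Unset Printing Implicit Defensive.

Import Order.TTheory GRing.Theory Num.Theory.
Import numFieldNormedType.Exports.

Local Open Scope classical_set_scope.
Local Open Scope ring_scope.

(* Collect the tangent vectors and the normals as the rows of a square frame F.
   The Gauss-Weingarten equations become d_j F = B_j H F, where H is the block
   diagonal matrix of eta and mu, and B_j is skew with off-diagonal blocks the
   second fundamental forms. Hence F^T H F' is constant for any two solutions
   F and F': this makes the Gram matrix of a solution constant, and it makes
   (F^T H F)^-1 F^T H F' a constant isometry carrying F to F'.

   The Codazzi equations say that d_i B_j is symmetric in i and j; associativity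
   says exactly that the matrices B_i H commute at each point (Gauss and Ricci
   equations). So the integrability conditions of d_j F = t B_j H F hold for all
   t, and F can be found as a power series at t = 1: F = sum_k F_k with F_0
   constant and d_j F_(k+1) = B_j H F_k, where each F_(k+1) comes from the
   Poincare lemma and the series is geometric on a small ball. No theory of
   ordinary differential equations is needed. *)

(** * Directional derivatives and strict differentiability *)

(** Smoothness is a condition on iterated partial derivatives alone, so strict differentiability at
    a point is derived from the continuity of the partials. It supplies the derivative along rays
    used in the Poincare lemma and in the bounds on the series. The integrability condition with
    parameter t reads t (d_i(B_j H) - d_j(B_i H)) + t^2 [B_j H, B_i H] = 0. Its two orders vanish
    separately, which is why each term of the series yields a closed form for the next one. The
    constant term F_0 cannot be arbitrary: the frame is adapted only if F_0 G F_0^T is the inverse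
    of H. The signature hypothesis enters here and nowhere else, through Sylvester's classification
    of forms. A frame contains only first derivatives of r. The immersion itself therefore costs one
    more Poincare lemma, whose closedness condition is the symmetry of the second fundamental forms;
    in the uniqueness part it costs the translation of the motion. *)

Section Lines.
Variables (R : realType) (V : normedModType R).

Lemma is_derive_line (W : normedModType R) (f : V -> W) (z v : V) (t : R)
    (df : W) :
  is_derive (t *: v + z) v f df ->
  is_derive t (1 : R) (fun s : R => f (s *: v + z)) df.
Proof.
have E : (fun h : R => h^-1 *: (((fun s : R => f (s *: v + z)) \o shift t)
                                  (h *: (1 : R)) - f (t *: v + z)))
       = (fun h : R => h^-1 *: ((f \o shift (t *: v + z)) (h *: v)
                                  - f (t *: v + z))).
  by apply/funext => h /=; rewrite [h *: 1]mulr1 scalerDl addrA.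
by move=> [df1 df2]; split; [rewrite /derivable E|rewrite /derive E].
Qed.

(** Pulling back along [s |-> (s * h) *: v + z] to the unit interval treats both signs of [h] at
    once. *)
Lemma mvt_line (f : V -> R) (z v : V) (h : R) :
  (forall s : R, 0 <= s <= 1 -> derivable f ((s * h) *: v + z) v) ->
  exists2 s : R, 0 <= s <= 1 &
    f (h *: v + z) - f z = h * 'D_v f ((s * h) *: v + z).
Proof.
move=> fd.
pose phi := fun s : R => f ((s * h) *: v + z).
have phid (s : R) : 0 <= s <= 1 ->
    is_derive s (1 : R) phi (h * 'D_v f ((s * h) *: v + z)).
  move=> s01.
  have d1 : is_derive (s * h) (1 : R) (fun s => f (s *: v + z))
      ('D_v f ((s * h) *: v + z)).
    by apply: is_derive_line; apply: derivableP; exact: fd.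
  have d2 : is_derive s (1 : R) (fun s : R => s * h) h.
    have := @is_deriveM R R id (cst h) s 1 1 0 (is_derive_id _ _)
      (is_derive_cst _ _ _).
    by move/is_derive_eq; apply; rewrite scaler0 add0r /= [_ *: 1]mulr1.
  have := @is_derive1_comp R (fun s => f (s *: v + z)) (fun s : R => s * h)
    s ('D_v f ((s * h) *: v + z)) h d1 d2.
  by move/is_derive_eq; apply; rewrite mulrC.
have [s s01 E] : exists2 c : R, c \in `[0, 1]%R &
    phi 1 - phi 0 = h * 'D_v f ((c * h) *: v + z) * (1 - 0).
  apply: (@MVT_segment R phi) => //.
    by move=> x /[!in_itv]/= /andP[x0 x1]; apply: phid; rewrite !ltW.
  apply: derivable_within_continuous => x /[!in_itv]/= x01.
  by have [] := phid x x01.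
exists s; first by move: s01; rewrite in_itv.
by move: E; rewrite /phi mul1r mul0r scale0r add0r subr0 mulr1.
Qed.

End Lines.

(** * The supremum norm on row vectors *)

Section Rows.
Variables (R : realType) (N : nat).
Implicit Types u v w x y : 'rV[R]_N.

Lemma normr_row_lt u (d : R) :
  0 < d -> (forall j, `|u 0 j| < d) -> `|u| < d.
Proof.
move=> d0 H; have : ball (0 : 'rV[R]_N) d u.
  by split=> // i j; rewrite /ball /= mxE sub0r normrN (ord1 i).
by rewrite -ball_normE /= sub0r normrN.
Qed.

Lemma normr_row_le u (d : R) :
  0 <= d -> (forall j, `|u 0 j| <= d) -> `|u| <= d.
Proof.
move=> d0 H; apply/ler_addgt0Pr => e e0; apply/ltW/normr_row_lt.
  by rewrite ltr_wpDl.
by move=> j; rewrite (le_lt_trans (H j)) // ltrDl.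
Qed.

Lemma ler_normr_coord u j : `|u 0 j| <= `|u|.
Proof.
apply/ler_addgt0Pr => e e0.
have : ball (0 : 'rV[R]_N) (`|u| + e) u.
  by rewrite -ball_normE /= sub0r normrN ltrDl.
by move=> [_ /(_ 0 j)]; rewrite /ball /= mxE sub0r normrN => /ltW.
Qed.

Lemma normr_delta_mx (i : 'I_N) : `|delta_mx 0 i : 'rV[R]_N| <= 1.
Proof.
by apply: normr_row_le => // j; rewrite mxE eqxx /=; case: eqP;
  rewrite ?normr1 ?normr0.
Qed.

End Rows.

Section StrictDifferentiability.
Variables (R : realType) (N : nat).
Notation e_ i := (delta_mx 0 i : 'rV[R]_N).
Variables (f : 'rV[R]_N -> R) (u : 'rV[R]_N).
Hypothesis fd : \forall w \near u, forall i, derivable f w (e_ i).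
Hypothesis fc : forall i, {for u, continuous (partial i f)}.

(** The segment from [x] to [y] is replaced by a path along the coordinate axes. The mean value
    theorem on each edge produces a partial derivative near [u], which is close to its value at
    [u]. *)
Lemma strictly_differentiable (eps : R) : 0 < eps ->
  exists2 d : R, 0 < d & forall x y, `|x - u| < d -> `|y - u| < d ->
    `|f y - f x - \sum_i (y - x) 0 i * partial i f u| <= eps * `|y - x|.
Proof.
move=> eps0.
(* Each of the [N] edges gets an equal share; [N.+1] keeps [eps'] positive when [N = 0]. *)
pose eps' := eps / (N.+1%:R).
have eps'0 : 0 < eps' by rewrite divr_gt0.
have : \forall w \near u, (forall i, derivable f w (e_ i)) /\
    forall i, `|partial i f u - partial i f w| <= eps'.
  have H i : \forall w \near u, `|partial i f u - partial i f w| <= eps'.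
    have H : partial i f @ nbhs u --> partial i f u by exact: fc.
    by move/cvgrPdist_le : H => /(_ _ eps'0).
  by apply: filterI => //; exact: (@filter_forall _ _
    (fun i w => `|partial i f u - partial i f w| <= eps') (nbhs u) _ H).
rewrite -nbhs_nearE => /nbhs_normP[d d0 dP].
exists d => // x y xu yu.
(* The corners of the path: the first [k] coordinates come from [y], the others from [x]. The edges
   stay in the ball because it is a cube. *)
pose z k : 'rV[R]_N := \row_(j < N) (if (j < k)%N then y 0 j else x 0 j).
have zS (k : 'I_N) : z k.+1 = (y 0 k - x 0 k) *: e_ k + z k.
  apply/rowP => j; rewrite !mxE eqxx /= ltnS leq_eqVlt.
  case: (eqVneq j k) => [->|jk]; first by rewrite eqxx ltnn /= mulr1 subrK.
  by rewrite (inj_eq val_inj) (negbTE jk) /= mulr0 add0r.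
have -> : f y - f x = \sum_(i < N) (f (z i.+1) - f (z i)).
  rewrite -(big_mkord xpredT (fun i => f (z i.+1) - f (z i))).
  rewrite (@telescope_sumr _ 0 N (fun i => f (z i))) //; congr (f _ - f _).
    by apply/rowP => j; rewrite mxE ltn_ord.
  by apply/rowP => j; rewrite mxE.
rewrite -sumrB.
have N0 : (N.+1%:R : R) != 0 by rewrite pnatr_eq0.
apply: (@le_trans _ _ (\sum_(i < N) eps' * `|y - x|)); last first.
  rewrite sumr_const card_ord -mulrnAl ler_wpM2r // /eps' -mulr_natr.
  rewrite mulrAC -mulrA ger_pMr // ler_pdivrMr // mul1r ler_nat //.
apply: le_trans (ler_norm_sum _ _ _) _; apply: ler_sum => k _.
have inb (s : R) : 0 <= s <= 1 ->
    `|u - ((s * (y 0 k - x 0 k)) *: e_ k + z k)| < d.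
  move=> /andP[s0 s1]; apply: normr_row_lt => // j.
  have xj := le_lt_trans (ler_normr_coord _ j) xu.
  have yj := le_lt_trans (ler_normr_coord _ j) yu.
  move: xj yj; rewrite !mxE eqxx /=; case: (eqVneq j k) => [->|jk].
    rewrite ltnn /= mulr1 => xj yj.
    rewrite -normrN opprB.
    have -> : s * (y 0 k - x 0 k) + x 0 k - u 0 k =
      (1 - s) * (x 0 k - u 0 k) + s * (y 0 k - u 0 k) by ring.
    move: xj yj; rewrite !ltr_norml => /andP[a1 a2] /andP[b1 b2].
    have [->|sn1] := eqVneq s 1; first by apply/andP; split; lra.
    have s1' : 0 < 1 - s by rewrite subr_gt0 lt_neqAle sn1.
    have p1 : 0 < (1 - s) * (d - (x 0 k - u 0 k)).
      by apply: mulr_gt0 => //; rewrite subr_gt0.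
    have p2 : 0 < (1 - s) * (x 0 k - u 0 k + d).
      by rewrite mulr_gt0 // -(opprK d) subr_gt0.
    have p3 : 0 <= s * (d - (y 0 k - u 0 k)).
      by rewrite mulr_ge0 // subr_ge0 ltW.
    have p4 : 0 <= s * (y 0 k - u 0 k + d).
      by rewrite mulr_ge0 // -(opprK d) subr_ge0 ltW.
    by apply/andP; split; lra.
  by rewrite mulr0 add0r => xj yj; rewrite distrC; case: ifP.
have [s s01 Es] : exists2 s : R, 0 <= s <= 1 &
    f ((y 0 k - x 0 k) *: e_ k + z k) - f (z k) = (y 0 k - x 0 k) *
    'D_(e_ k) f ((s * (y 0 k - x 0 k)) *: e_ k + z k).
  by apply: mvt_line => s s01; have [] := dP _ (inb s s01).
have [_ /(_ k) H] := dP _ (inb s s01).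
rewrite zS Es !mxE -mulrBr normrM mulrC ler_pM //.
  by rewrite distrC; exact: H.
by have := ler_normr_coord (y - x) k; rewrite !mxE.
Qed.

Lemma is_derive_partial (v : 'rV[R]_N) :
  is_derive u v f (\sum_i v 0 i * partial i f u).
Proof.
suff H : h^-1 *: ((f \o shift u) (h *: v) - f u) @[h --> 0^'] -->
    (\sum_i v 0 i * partial i f u).
  by split; [apply/cvg_ex; eexists; exact: H|exact/cvg_lim].
apply/cvgrPdist_le => eps eps0 /=.
have eps'0 : 0 < eps / (`|v| + 1) by rewrite divr_gt0 // ltr_wpDl.
have [d d0 dP] := strictly_differentiable eps'0.
near=> h.
have h0 : h != 0 by near: h; exact: nbhs_dnbhs_neq.
have hd : `|h| < d / (`|v| + 1).
  by near: h; apply: dnbhs0_lt; rewrite divr_gt0 // ltr_wpDl.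
have := dP u (h *: v + u).
rewrite subrr normr0 addrK => /(_ d0).
have hvd : `|h *: v| < d.
  rewrite normrZ; apply: (@le_lt_trans _ _ (`|h| * (`|v| + 1))).
    by rewrite ler_wpM2l // lerDl.
  by rewrite -ltr_pdivlMr // ltr_wpDl.
move=> /(_ hvd).
have -> : \sum_i (h *: v) 0 i * partial i f u =
    h * \sum_i v 0 i * partial i f u.
  by rewrite mulr_sumr; apply: eq_bigr => i _; rewrite mxE mulrA.
move=> H.
rewrite distrC -(ler_pM2l (_ : 0 < `|h|)) ?normr_gt0 // -normrM mulrBr.
have -> : h * (h^-1 *: (f (h *: v + u) - f u)) = f (h *: v + u) - f u.
  by rewrite -[_ *: _]/(_ * _) mulrA divff // mul1r.
apply: le_trans H _; rewrite normrZ mulrCA ler_wpM2l //.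
rewrite -mulrA ger_pMr // mulrC ler_pdivrMr ?ltr_wpDl // mul1r lerDl //.
Unshelve. all: by end_near. Qed.

(** Strict differentiability with constant 1 bounds [|f w - f u|] by a multiple of [|w - u|]. This
    gives continuity of functions known only through their partial derivatives, such as line
    integrals. *)
Lemma continuous_partial : {for u, continuous f}.
Proof.
suff : f @ nbhs u --> f u by [].
apply/cvgrPdist_le => eps eps0 /=.
have [d d0 dP] := strictly_differentiable (ltr01 : 0 < (1 : R)).
pose C := \sum_i `|partial i f u| + 1.
have C0 : 0 < C by rewrite /C ltr_wpDl // sumr_ge0.
near=> w.
have wd : `|w - u| < d.
  rewrite distrC; near: w; exact: cvgr_dist_lt.
have we : `|w - u| <= eps / C.
  by rewrite distrC; near: w; apply: cvgr_dist_le => //; rewrite divr_gt0.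
have := dP u w; rewrite subrr normr0 mul1r => /(_ d0 wd) H.
rewrite distrC -[f w - f u](subrK (\sum_i (w - u) 0 i * partial i f u)).
apply: le_trans (ler_normD _ _) _.
apply: (@le_trans _ _ (`|w - u| * C)); last by rewrite -ler_pdivlMr.
rewrite /C mulrDr mulr1 addrC lerD // mulr_sumr.
apply: le_trans (ler_norm_sum _ _ _) _; apply: ler_sum => i _.
by rewrite normrM ler_wpM2r // ler_normr_coord.
Unshelve. all: by end_near. Qed.

End StrictDifferentiability.

(** * Smooth functions on an open set *)

Section DeriveFun.
Variables (R : realType) (V : normedModType R).

Lemma is_derive_translate (W : normedModType R) (f : V -> W) (a x v : V)
    (df : W) :
  is_derive (a + x) v f df -> is_derive x v (fun w => f (a + w)) df.
Proof.
have E : (fun h : R => h^-1 *: (((fun w => f (a + w)) \o shift x) (h *: v)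
                                  - f (a + x)))
       = (fun h : R => h^-1 *: ((f \o shift (a + x)) (h *: v) - f (a + x))).
  by apply/funext => h /=; rewrite addrCA.
by move=> [df1 df2]; split; [rewrite /derivable E|rewrite /derive E].
Qed.

Lemma is_derive_sum_fun (W : normedModType R) (I : Type) (s : seq I)
    (h : I -> V -> W) (dh : I -> W) (x v : V) :
  (forall i, is_derive x v (h i) (dh i)) ->
  is_derive x v (fun u => \sum_(i <- s) h i u) (\sum_(i <- s) dh i).
Proof.
move=> H; elim: s => [|i s IH].
  rewrite big_nil (_ : (fun _ => _) = cst 0); first exact: is_derive_cst.
  by apply/funext => u; rewrite big_nil.
rewrite big_cons (_ : (fun _ => _) = h i + (fun u => \sum_(i <- s) h i u)).
  exact: is_deriveD.
by apply/funext => u; rewrite big_cons.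
Qed.

End DeriveFun.

Section SmoothCalculus.
Variables (R : realType) (N : nat) (U : set 'rV[R]_N).
Hypothesis Uo : open U.
Notation V := 'rV[R]_N.
Notation e_ i := (delta_mx 0 i : 'rV[R]_N).

Lemma open_near_eq (W : normedModType R) (f g : V -> W) u :
  {in U, f =1 g} -> U u -> \forall w \near u, f w = g w.
Proof.
move=> fg Uu; have : \forall w \near u, U w by exact: open_nbhs_nbhs.
by apply: filterS => w Uw; apply: fg; rewrite inE.
Qed.

Lemma partial_eq_on (W : normedModType R) (f g : V -> W) i u :
  {in U, f =1 g} -> U u -> partial i f u = partial i g u.
Proof. by move=> fg Uu; apply: near_eq_derive; exact: open_near_eq. Qed.

(* Continuous on [U] with all first partial derivatives existing there; the
   derivatives themselves are only asked to be continuous by [ck_on]. *)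
Definition partials_exist_on (W : normedModType R) (f : V -> W) :=
  forall u, U u ->
    {for u, continuous f} /\ (forall i, derivable f u (e_ i)).

(** Stratifying smoothness by order allows induction on [n]: the product rule expresses a derivative
    through functions that are controlled one level lower. *)
Fixpoint ck_on (W : normedModType R) n (f : V -> W) : Prop :=
  partials_exist_on f /\
  if n is n'.+1 then forall i, ck_on n' (partial i f) else True.

(** [partials] applies the last index of the list first, and this is the derivative that [ck_on]
    peels off; hence the induction on the end of the list. *)
Lemma smooth_onP (W : normedModType R) (f : V -> W) :
  smooth_on U f <-> forall n, ck_on n f.
Proof.
split=> [sf n|].
  elim: n f sf => [|n IH] f sf /=; split=> //.
  - by move=> u Uu; exact: (sf [::]).
  - by move=> u Uu; exact: (sf [::]).
  - move=> i; apply: IH => s u Uu.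
    by have := sf (rcons s i) u Uu; rewrite /partials foldr_rcons.
move=> ckf s; elim/last_ind: s f ckf => [|s i IH] f ckf u Uu.
  by have [] := ckf 0%N => /(_ u Uu).
rewrite /partials foldr_rcons; apply: IH => // n.
by have [_] := ckf n.+1; exact.
Qed.

Lemma partials_exist_eq_on (W : normedModType R) (f g : V -> W) :
  {in U, f =1 g} -> partials_exist_on f -> partials_exist_on g.
Proof.
move=> fg df u Uu; have [fc fd] := df u Uu; have fgn := open_near_eq fg Uu.
split; last by move=> i; apply: near_eq_derivable (fd i).
have fcu : f @ nbhs u --> f u by exact: fc.
suff : g @ nbhs u --> g u by [].
rewrite -(nbhs_singleton fgn); apply: cvg_trans fcu.
by apply: near_eq_cvg; apply: filterS fgn => w ->.
Qed.

Lemma ck_eq_on (W : normedModType R) n (f g : V -> W) :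
  {in U, f =1 g} -> ck_on n f -> ck_on n g.
Proof.
elim: n f g => [|n IH] f g fg /= [df ckf]; split=> //.
- exact: partials_exist_eq_on df.
- exact: partials_exist_eq_on df.
- move=> i; apply: IH (ckf i) => u; rewrite inE => Uu.
  exact: partial_eq_on.
Qed.

Lemma ck_onW (W : normedModType R) n (f : V -> W) : ck_on n.+1 f -> ck_on n f.
Proof.
elim: n f => [|n IH] f; first by case.
by move=> [df ckf]; split=> // i; apply: IH; exact: ckf.
Qed.

Lemma ck_on_exist (W : normedModType R) n (f : V -> W) :
  ck_on n f -> partials_exist_on f.
Proof. by case: n => [|n] []. Qed.

Lemma partialD (W : normedModType R) (f g : V -> W) i u :
  partials_exist_on f -> partials_exist_on g -> U u ->
  partial i (fun w => f w + g w) u = partial i f u + partial i g u.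
Proof.
move=> df dg Uu; rewrite /partial.
by apply: (@deriveD _ _ _ f g); [case: (df u Uu)|case: (dg u Uu)].
Qed.

Lemma partialM (f g : V -> R) i u :
  partials_exist_on f -> partials_exist_on g -> U u ->
  partial i (fun w => f w * g w) u = partial i f u * g u + f u * partial i g u.
Proof.
move=> df dg Uu; rewrite /partial.
have -> : (fun w => f w * g w) = f * g by [].
rewrite (@deriveM _ _ f g); [|by case: (df u Uu)|by case: (dg u Uu)].
by rewrite addrC -[_ *: _]/(_ * _) -[f u *: _]/(_ * _) [g u * _]mulrC.
Qed.

Lemma partials_exist_cst (W : normedModType R) (c : W) :
  partials_exist_on (fun=> c).
Proof. by move=> u Uu; split; [exact: cst_continuous|move=> i]. Qed.

Lemma partials_existD (W : normedModType R) (f g : V -> W) :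
  partials_exist_on f -> partials_exist_on g ->
  partials_exist_on (fun w => f w + g w).
Proof.
move=> df dg u Uu; have [fc fd] := df u Uu; have [gc gd] := dg u Uu; split.
  by apply: (@continuousD _ _ _ f g).
by move=> i; apply: (@derivableD _ _ _ f g).
Qed.

Lemma partials_existM (f g : V -> R) :
  partials_exist_on f -> partials_exist_on g ->
  partials_exist_on (fun w => f w * g w).
Proof.
move=> df dg u Uu; have [fc fd] := df u Uu; have [gc gd] := dg u Uu; split.
  by apply: (@continuousM _ _ f g).
by move=> i; apply: (@derivableM _ _ f g).
Qed.

Lemma ck_onD (W : normedModType R) n (f g : V -> W) :
  ck_on n f -> ck_on n g -> ck_on n (fun w => f w + g w).
Proof.
elim: n f g => [|n IH] f g /= [df ckf] [dg ckg].
  by split=> //; exact: partials_existD.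
split=> [|i]; first exact: partials_existD.
apply: (@ck_eq_on _ n (fun w => partial i f w + partial i g w)).
  by move=> u; rewrite inE => Uu; rewrite partialD.
exact: IH.
Qed.

Lemma ck_onM n (f g : V -> R) :
  ck_on n f -> ck_on n g -> ck_on n (fun w => f w * g w).
Proof.
elim: n f g => [|n IH] f g.
  by move=> [df _] [dg _]; split; first exact: partials_existM.
move=> ckf ckg; have [df pf] := ckf; have [dg pg] := ckg.
split=> [|i]; first exact: partials_existM.
apply: (@ck_eq_on _ n (fun w => partial i f w * g w + f w * partial i g w)).
  by move=> u; rewrite inE => Uu; rewrite partialM.
apply: ck_onD; first exact: IH (pf i) (ck_onW ckg).
exact: IH (ck_onW ckf) (pg i).
Qed.

Lemma partial_cst (W : normedModType R) (c : W) (i : 'I_N) (u : V) :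
  partial i (fun=> c) u = 0.
Proof. exact: derive_cst. Qed.

Lemma ck_on_cst (W : normedModType R) n (c : W) : ck_on n (fun=> c).
Proof.
elim: n c => [|n IH] c /=; split=> //; try exact: partials_exist_cst.
move=> i; rewrite (_ : partial i _ = fun=> 0); first exact: IH.
by apply/funext => u; exact: partial_cst.
Qed.

Lemma ck_on_sum (W : normedModType R) n (I : Type) (s : seq I)
    (f : I -> V -> W) :
  (forall i, ck_on n (f i)) -> ck_on n (fun w => \sum_(i <- s) f i w).
Proof.
move=> ckf; elim: s => [|i s IH].
  rewrite (_ : (fun _ => _) = fun=> 0); first exact: ck_on_cst.
  by apply/funext => u; rewrite big_nil.
rewrite (_ : (fun _ => _) = fun w => f i w + \sum_(i <- s) f i w).
  exact: ck_onD.
by apply/funext => u; rewrite big_cons.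
Qed.

Lemma partial_sum (W : normedModType R) (I : Type) (s : seq I)
    (f : I -> V -> W) j u :
  (forall i, partials_exist_on (f i)) -> U u ->
  partial j (fun w => \sum_(i <- s) f i w) u
  = \sum_(i <- s) partial j (f i) u.
Proof.
move=> df Uu; apply: (derive_val (is_derive := is_derive_sum_fun _ _)) => i.
by apply: derivableP; case: (df i u Uu).
Qed.

Lemma smooth_on_exist (W : normedModType R) (f : V -> W) :
  smooth_on U f -> partials_exist_on f.
Proof. by move/smooth_onP/(_ 0%N)/ck_on_exist. Qed.

Lemma smooth_on_partial (W : normedModType R) (f : V -> W) i :
  smooth_on U f -> smooth_on U (partial i f).
Proof.
by move/smooth_onP => sf; apply/smooth_onP => n; have [_] := sf n.+1; exact.
Qed.

Lemma smooth_on_eq (W : normedModType R) (f g : V -> W) :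
  {in U, f =1 g} -> smooth_on U f -> smooth_on U g.
Proof.
by move=> fg /smooth_onP sf; apply/smooth_onP => n; exact: ck_eq_on (sf n).
Qed.

Lemma smooth_onM (f g : V -> R) :
  smooth_on U f -> smooth_on U g -> smooth_on U (fun w => f w * g w).
Proof.
move=> /smooth_onP sf /smooth_onP sg; apply/smooth_onP => n.
exact: ck_onM.
Qed.

Lemma smooth_on_cst (W : normedModType R) (c : W) : smooth_on U (fun=> c).
Proof. by apply/smooth_onP => n; exact: ck_on_cst. Qed.

Lemma smooth_on_sum (W : normedModType R) (I : Type) (s : seq I)
    (f : I -> V -> W) :
  (forall i, smooth_on U (f i)) -> smooth_on U (fun w => \sum_(i <- s) f i w).
Proof.
move=> sf; apply/smooth_onP => n; apply: ck_on_sum => i.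
by have /smooth_onP := sf i; exact.
Qed.

Lemma smooth_from_partials (f : V -> R) :
  partials_exist_on f -> (forall i, smooth_on U (partial i f)) ->
  smooth_on U f.
Proof.
move=> df sf; apply/smooth_onP => -[|n]; split=> // i.
by have /smooth_onP := sf i; exact.
Qed.

Lemma smooth_is_derive (f : V -> R) u (v : V) : smooth_on U f -> U u ->
  is_derive u v f (\sum_i v 0 i * partial i f u).
Proof.
move=> sf Uu; apply: is_derive_partial.
  have : \forall w \near u, U w by exact: open_nbhs_nbhs.
  by apply: filterS => w Uw i; have [] := smooth_on_exist sf Uw.
by move=> i; have [] := smooth_on_exist (smooth_on_partial i sf) Uu.
Qed.

Lemma continuous_mxP m n (f : V -> 'M[R]_(m, n)) (u : V) :
  {for u, continuous f} <-> forall a b, {for u, continuous (fun w => f w a b)}.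
Proof.
split=> [fc a b|fc].
  have fcu : f @ nbhs u --> f u by exact: fc.
  exact: (cvg_comp _ _ fcu (@coord_continuous R m n a b (f u))).
suff : f @ nbhs u --> f u by [].
apply/cvgrPdist_lt => e e0.
have H (ab : 'I_m * 'I_n) :
    \forall w \near u, `|f u ab.1 ab.2 - f w ab.1 ab.2| < e.
  have : (fun w => f w ab.1 ab.2) @ nbhs u --> f u ab.1 ab.2 by exact: fc.
  by move/cvgrPdist_lt/(_ _ e0).
have HH : \forall w \near u, forall ab : 'I_m * 'I_n,
    `|f u ab.1 ab.2 - f w ab.1 ab.2| < e.
  exact: (@filter_forall _ _ (fun (ab : 'I_m * 'I_n) w =>
    `|f u ab.1 ab.2 - f w ab.1 ab.2| < e) (nbhs u) _ H).
suff HH' : \forall w \near u, `|f u - f w| < e by exact: HH'.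
apply: filterS HH => w Hw.
have : ball (f u) e (f w) by split=> // a b; exact: (Hw (a, b)).
by rewrite -ball_normE.
Qed.

Lemma partial_mx m n (f : V -> 'M[R]_(m, n)) i u a b :
  partials_exist_on f -> U u ->
  partial i f u a b = partial i (fun w => f w a b) u.
Proof.
by move=> df Uu; rewrite /partial derive_mx ?mxE //; case: (df u Uu).
Qed.

Lemma partials_exist_mxP m n (f : V -> 'M[R]_(m, n)) :
  partials_exist_on f <-> forall a b, partials_exist_on (fun w => f w a b).
Proof.
split=> [df a b u Uu|df u Uu].
  have [fc fd] := df u Uu; split; first by have /continuous_mxP := fc; exact.
  by move=> i; have /derivable_mxP := fd i; exact.
split; first by apply/continuous_mxP => a b; have [] := df a b u Uu.
by move=> i; apply/derivable_mxP => a b; have [] := df a b u Uu.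
Qed.

Lemma ck_on_mxP k m n (f : V -> 'M[R]_(m, n)) :
  ck_on k f <-> forall a b, ck_on k (fun w => f w a b).
Proof.
elim: k f => [|k IH] f /=.
  split=> [[/partials_exist_mxP df _] a b|H]; first by split.
  by split=> //; apply/partials_exist_mxP => a b; case: (H a b).
split=> [[df ckf] a b|H].
  split=> [|i]; first by have /partials_exist_mxP := df; exact.
  apply: (@ck_eq_on _ _ (fun w => partial i f w a b)).
    by move=> u; rewrite inE => Uu; rewrite partial_mx.
  by have /IH := ckf i; exact.
have df : partials_exist_on f.
  by apply/partials_exist_mxP => a b; case: (H a b).
split=> // i; apply/IH => a b.
apply: (@ck_eq_on _ _ (partial i (fun w => f w a b))); last first.
  by case: (H a b) => _; exact.
by move=> u; rewrite inE => Uu; rewrite partial_mx.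
Qed.

Lemma smooth_on_mxP m n (f : V -> 'M[R]_(m, n)) :
  smooth_on U f <-> forall a b, smooth_on U (fun w => f w a b).
Proof.
split=> [/smooth_onP sf a b|sf]; apply/smooth_onP => k.
  by have /ck_on_mxP := sf k; exact.
by apply/ck_on_mxP => a b; have /smooth_onP := sf a b; exact.
Qed.

End SmoothCalculus.

Lemma smooth_onS (R : realType) (N : nat) (U U' : set 'rV[R]_N)
    (W : normedModType R) (f : 'rV[R]_N -> W) :
  U `<=` U' -> smooth_on U' f -> smooth_on U f.
Proof. by move=> UU' sf s u /UU'; exact: sf. Qed.

Lemma ler_dist_half (R : realFieldType) (eps x y z t : R) :
  `|x - z| <= eps / 2 -> `|y - t| <= eps / 2 -> z = t -> `|x - y| <= eps.
Proof.
move=> xz yt zt; move: xz yt; rewrite zt !ler_norml => /andP[? ?] /andP[? ?].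
by apply/andP; split; lra.
Qed.

Lemma subrACA (V : zmodType) (x y z t : V) :
  x - y - (z - t) = x - z - (y - t).
Proof. by rewrite !opprB addrACA [RHS]addrACA [- z - y]addrC. Qed.

(** * Symmetry of second partial derivatives *)

Section Schwarz.
Variables (R : realType) (N : nat) (U : set 'rV[R]_N).
Hypothesis Uo : open U.
Notation V := 'rV[R]_N.
Notation e_ i := (delta_mx 0 i : 'rV[R]_N).

(** The mean value theorem is used twice: along [e_i] for the difference of [f] in the direction
    [e_j], then along [e_j] for [partial i f]. *)
Lemma second_difference (f : V -> R) (u : V) (r h : R) (i j : 'I_N) :
  smooth_on U f -> (forall w, `|u - w| < r -> U w) -> 0 < h -> 2 * h < r ->
  exists2 w, `|u - w| <= 2 * h &
    (f (h *: e_ j + (h *: e_ i + u)) - f (h *: e_ i + u))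
    - (f (h *: e_ j + u) - f u) = h * (h * partial j (partial i f) w).
Proof.
move=> sf Ur h0 hr.
have near_u (s t : R) : 0 <= s <= 1 -> 0 <= t <= 1 ->
    `|u - ((t * h) *: e_ j + ((s * h) *: e_ i + u))| <= 2 * h.
  move=> /andP[s0 s1] /andP[t0 t1].
  rewrite -normrN opprB addrA addrK (le_trans (ler_normD _ _)) //.
  rewrite mulr2n mulrDl mul1r lerD // normrZ.
    rewrite ger0_norm ?mulr_ge0 ?(ltW h0) //.
    rewrite -[leRHS]mulr1 ler_pM ?mulr_ge0 ?(ltW h0) ?normr_delta_mx //.
    by rewrite ger_pMl.
  rewrite ger0_norm ?mulr_ge0 ?(ltW h0) //.
  rewrite -[leRHS]mulr1 ler_pM ?mulr_ge0 ?(ltW h0) ?normr_delta_mx //.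
  by rewrite ger_pMl.
have Ust (s t : R) : 0 <= s <= 1 -> 0 <= t <= 1 ->
    U ((t * h) *: e_ j + ((s * h) *: e_ i + u)).
  by move=> s01 t01; apply: Ur; rewrite (le_lt_trans (near_u _ _ s01 t01)).
have i0 : 0 <= (0 : R) <= 1 by rewrite lexx ler01.
have i1 : 0 <= (1 : R) <= 1 by rewrite lexx ler01.
pose phi w := f (h *: e_ j + w) - f w.
have phid (s : R) : 0 <= s <= 1 -> is_derive ((s * h) *: e_ i + u) (e_ i) phi
    (partial i f (h *: e_ j + ((s * h) *: e_ i + u))
      - partial i f ((s * h) *: e_ i + u)).
  move=> s01.
  apply: (@is_deriveB _ _ _ (fun w => f (h *: e_ j + w)) f).
    apply: is_derive_translate; apply: derivableP.
    have := smooth_on_exist sf (Ust _ _ s01 i1); rewrite mul1r => -[_].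
    exact.
  apply: derivableP.
  have := smooth_on_exist sf (Ust _ _ s01 i0).
  by rewrite mul0r scale0r add0r => -[_]; exact.
have [s s01 Es] : exists2 s : R, 0 <= s <= 1 & phi (h *: e_ i + u) - phi u =
    h * 'D_(e_ i) phi ((s * h) *: e_ i + u).
  by apply: mvt_line => s s01; have [] := phid s s01.
have [t t01 Et] : exists2 t : R, 0 <= t <= 1 &
    partial i f (h *: e_ j + ((s * h) *: e_ i + u))
      - partial i f ((s * h) *: e_ i + u) =
    h * 'D_(e_ j) (partial i f) ((t * h) *: e_ j + ((s * h) *: e_ i + u)).
  apply: mvt_line => t t01.
  by have [_] := smooth_on_exist (smooth_on_partial i sf) (Ust _ _ s01 t01).
exists ((t * h) *: e_ j + ((s * h) *: e_ i + u)); first exact: near_u.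
rewrite -/(phi (h *: e_ i + u)) -/(phi u) Es.
by rewrite (derive_val (is_derive := phid s s01)) Et.
Qed.

(** The second difference is symmetric in [i] and [j], so one mixed derivative at [w] equals the
    other at [w'], both points being within [2 * h] of [u]. Continuity at [u] does the rest. *)
Lemma schwarz (f : V -> R) (u : V) i j : smooth_on U f -> U u ->
  partial i (partial j f) u = partial j (partial i f) u.
Proof.
move=> sf Uu; apply/eqP; rewrite -subr_eq0 -normr_le0.
apply/ler_addgt0Pr => eps eps0; rewrite add0r.
have cont a b : partial a (partial b f) @ nbhs u --> partial a (partial b f) u.
  have s2 := smooth_on_partial a (smooth_on_partial b sf).
  by have [] := smooth_on_exist s2 Uu.
have eps2 : 0 < eps / 2 by rewrite divr_gt0.
have : \forall w \near u, U w /\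
   (`|partial i (partial j f) u - partial i (partial j f) w| <= eps / 2 /\
    `|partial j (partial i f) u - partial j (partial i f) w| <= eps / 2).
  apply: filterI; first exact: open_nbhs_nbhs.
  by apply: filterI; move/cvgrPdist_le : (cont i j) (cont j i) => H1
     /cvgrPdist_le H2; [exact: H1|exact: H2].
move/nbhs_normP => [r r0 rP].
pose h := r / 4.
have h0 : 0 < h by rewrite divr_gt0.
have hr : 2 * h < r by have r0' : 0 < r := r0; rewrite /h; lra.
have Ur w : `|u - w| < r -> U w by move=> /rP[].
have [w wh Ew] := second_difference j i sf Ur h0 hr.
have [w' wh' Ew'] := second_difference i j sf Ur h0 hr.
have E : partial i (partial j f) w = partial j (partial i f) w'.
  apply: (mulfI (lt0r_neq0 h0)); apply: (mulfI (lt0r_neq0 h0)).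
  have pt : h *: e_ i + (h *: e_ j + u) = h *: e_ j + (h *: e_ i + u).
    by rewrite addrCA.
  rewrite pt subrACA in Ew; exact: eq_trans (esym Ew) Ew'.
have [_ [H1 _]] := rP w (le_lt_trans wh hr).
have [_ [_ H2]] := rP w' (le_lt_trans wh' hr).
exact: ler_dist_half H1 H2 E.
Qed.

End Schwarz.

(** * The Poincare lemma on star-shaped sets *)

Lemma derivable1_continuous (R : realType) (f : R -> R) (t : R) :
  derivable f t 1 -> {for t, continuous f}.
Proof. by move=> /derivable1_diffP/differentiable_continuous. Qed.

(** Continuity up to the endpoints and a derivative inside are exactly what the mean value theorem
    asks for, so one-sided derivatives never appear. *)
Lemma primitive_unit_interval (R : realType) (phi : R -> R) :
  (forall t : R, 0 <= t <= 1 -> {for t, continuous phi}) ->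
  let Q := fun x => parameterized_integral lebesgue_measure 0 x phi in
  [/\ Q 0 = 0, {within `[0, 1], continuous Q} &
      forall t : R, 0 < t < 1 -> is_derive t 1 Q (phi t)].
Proof.
move=> phic Q.
have phiw : {within `[0, 1], continuous phi}.
  by apply: continuous_in_subspaceT => t; rewrite inE /= in_itv /=; exact: phic.
have phii : lebesgue_measure.-integrable `[0, 1] (EFin \o phi).
  by apply: continuous_compact_integrable => //; exact: segment_compact.
split.
- by rewrite /Q /parameterized_integral set_itv1 Rintegral_set1.
- exact: parameterized_integral_continuous.
- move=> t /andP[t0 t1].
  have ct : {for t, continuous phi} by apply: phic; rewrite !ltW.
  have [] := continuous_FTC1_closed t1 phii t0 ct.
  by rewrite derive1E => d1 d2; split.
Qed.

Section Segment.
Variables (R : realType) (V : normedModType R).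

(** Compactness of the unit interval turns radii that vary along the segment into a single one. Both
    points in the hypothesis are free because the conclusion compares [w] with a point of the
    segment that need not be the centre of a ball of the cover. *)
Lemma near_segment (A : V -> V -> Prop) (x z : V) :
  (forall t : R, 0 <= t <= 1 -> exists2 r : R, 0 < r & forall p w,
     `|p - (t *: x + z)| < r -> `|w - (t *: x + z)| < r -> A p w) ->
  exists2 d : R, 0 < d & forall (t : R) w, 0 <= t <= 1 ->
     `|w - (t *: x + z)| < d -> A (t *: x + z) w.
Proof.
move=> H.
pose P (d t : R) := forall w, `|w - (t *: x + z)| < d -> A (t *: x + z) w.
have /compact_near_coveringP/(_ R (0%R)^'+ P _) cov :=
  @segment_compact R 0 1.
have {}cov : \forall d \near (0%R : R)^'+, `[0, 1]%classic `<=` P d.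
  apply: cov => t; rewrite /= in_itv /= => t01.
  have [r r0 rA] := H t t01.
  have r2 : 0 < r / 2 by rewrite divr_gt0.
  (* Half of [r] is spent on moving the parameter, half on the distance of [w]; adding 1 covers
     [x = 0]. *)
  have pos : 0 < r / 2 / (`|x| + 1) by rewrite divr_gt0 // ltr_wpDl.
  have near_t : \forall s \near t, `|t - s| < r / 2 / (`|x| + 1).
    by apply/nbhs_normP; exists (r / 2 / (`|x| + 1)).
  near=> s d.
  have st : `|s *: x + z - (t *: x + z)| < r / 2.
    rewrite opprD addrACA subrr addr0 -scalerBl normrZ.
    apply: (@le_lt_trans _ _ (`|s - t| * (`|x| + 1))).
      by rewrite ler_wpM2l // lerDl.
    rewrite -ltr_pdivlMr ?ltr_wpDl // distrC.
  have dr : d < r / 2 by near: d; exact: nbhs_right_lt.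
  move=> w wd; apply: rA.
    by rewrite (lt_trans st) // ltr_pdivrMr // ltr_pMr // ltr1n.
  rewrite -(subrKA (s *: x + z)) (le_lt_trans (ler_normD _ _)) //.
  by rewrite [r]splitr ltrD // (lt_trans wd).
have : \forall d \near (0%R : R)^'+, 0 < d /\ `[0, 1]%classic `<=` P d.
  by apply: filterI => //; exact: nbhs_right_gt.
move=> /filter_ex[d [d0 dP]]; exists d => // t w t01.
by apply: dP; rewrite /= in_itv.
Unshelve. all: by end_near. Qed.

End Segment.

Section Poincare.
Variables (R : realType) (N : nat) (U : set 'rV[R]_N) (u0 : 'rV[R]_N).
Hypothesis Uo : open U.
Hypothesis Ustar : forall u (t : R), U u -> 0 <= t <= 1 ->
  U (t *: (u - u0) + u0).
Notation V := 'rV[R]_N.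
Notation e_ i := (delta_mx 0 i : 'rV[R]_N).

Lemma smooth_is_derive_ray (f : V -> R) (x z : V) (t : R) :
  smooth_on U f -> U (t *: x + z) ->
  is_derive t (1 : R) (fun s : R => f (s *: x + z))
    (\sum_i x 0 i * partial i f (t *: x + z)).
Proof.
by move=> sf Ut; exact: (is_derive_line (smooth_is_derive Uo x sf Ut)).
Qed.

Lemma mean_value_ray (f : V -> R) (x z : V) :
  smooth_on U f -> (forall t : R, 0 <= t <= 1 -> U (t *: x + z)) ->
  exists2 t : R, 0 <= t <= 1 &
    f (x + z) - f z = \sum_i x 0 i * partial i f (t *: x + z).
Proof.
move=> sf Uz.
have [t t01 E] : exists2 t : R, 0 <= t <= 1 &
    f (1 *: x + z) - f z = 1 * 'D_x f ((t * 1) *: x + z).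
  apply: mvt_line => t t01; rewrite mulr1.
  by have [] := smooth_is_derive Uo x sf (Uz t t01).
exists t => //; move: E; rewrite scale1r mul1r mulr1 => ->.
exact: (derive_val (is_derive := smooth_is_derive Uo x sf (Uz t t01))).
Qed.

Variable g : 'I_N -> V -> R.
Hypothesis sg : forall i, smooth_on U (g i).
Hypothesis closed_g : forall u, U u -> forall i j,
  partial i (g j) u = partial j (g i) u.

Definition ray_integrand (u : V) (t : R) : R :=
  \sum_j (u - u0) 0 j * g j (t *: (u - u0) + u0).

(** The homotopy operator of the Poincare lemma is the value at [s = 1]. The upper limit is kept
    free so that derivatives in [u] come from the mean value theorem in [s] and not from
    differentiation under the integral sign. *)
Definition ray_integral (u : V) (s : R) : R :=
  parameterized_integral lebesgue_measure 0 s (ray_integrand u).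

Lemma ray_integralP (u : V) :
  (forall t : R, 0 <= t <= 1 -> U (t *: (u - u0) + u0)) ->
  [/\ ray_integral u 0 = 0, {within `[0, 1], continuous (ray_integral u)} &
      forall t : R, 0 < t < 1 ->
        is_derive t 1 (ray_integral u) (ray_integrand u t)].
Proof.
move=> Uu; apply: primitive_unit_interval => t t01.
apply: derivable1_continuous.
suff [] : is_derive t (1 : R) (ray_integrand u) (\sum_j (u - u0) 0 j *
   (\sum_i (u - u0) 0 i * partial i (g j) (t *: (u - u0) + u0))) by [].
apply: is_derive_sum_fun => j.
apply: (@is_deriveZ _ _ _ (fun s : R => g j (s *: (u - u0) + u0))).
by apply: smooth_is_derive_ray (Uu t t01).
Qed.

(** One radius must serve the whole ray, since the mean value theorem gives no control over its
    intermediate parameter. *)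
Lemma ray_tube (u : V) (i : 'I_N) (eps : R) : U u -> 0 < eps ->
  exists2 d : R, 0 < d & forall (t : R) w, 0 <= t <= 1 ->
    `|w - (t *: (u - u0) + u0)| < d ->
    [/\ U w, `|g i w - g i (t *: (u - u0) + u0)| <= eps &
      forall j, `|partial i (g j) w - partial i (g j) (t *: (u - u0) + u0)|
                <= eps].
Proof.
move=> Uu eps0.
apply: (@near_segment R 'rV[R]_N (fun p w => [/\ U w, `|g i w - g i p| <= eps &
  forall j, `|partial i (g j) w - partial i (g j) p| <= eps])) => t t01.
have Ut := Ustar Uu t01; set q := t *: _ + _ in Ut *.
have eps2 : 0 < eps / 2 by rewrite divr_gt0.
have H1 : \forall w \near q, U w by exact: open_nbhs_nbhs.
have H2 : \forall w \near q, `|g i q - g i w| <= eps / 2.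
  have c : g i @ nbhs q --> g i q by have [] := smooth_on_exist (sg i) Ut.
  by move/cvgrPdist_le : c => /(_ _ eps2).
have H3 : \forall w \near q, forall j,
    `|partial i (g j) q - partial i (g j) w| <= eps / 2.
  have H3' j : \forall w \near q,
      `|partial i (g j) q - partial i (g j) w| <= eps / 2.
    have c : partial i (g j) @ nbhs q --> partial i (g j) q.
      by have [] := smooth_on_exist (smooth_on_partial i (sg j)) Ut.
    by move/cvgrPdist_le : c => /(_ _ eps2).
  exact: (@filter_forall _ _ (fun j w =>
    `|partial i (g j) q - partial i (g j) w| <= eps / 2) (nbhs q) _ H3').
have : \forall w \near q, U w /\ (`|g i q - g i w| <= eps / 2 /\
    forall j, `|partial i (g j) q - partial i (g j) w| <= eps / 2).
  by apply: filterI => //; exact: filterI.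
move/nbhs_normP => [r r0 rP]; exists r => // p w.
rewrite distrC => /rP[Up [gp dp]]; rewrite distrC => /rP[Uw [gw dw]].
have half (a b c : R) : `|a - b| <= eps / 2 -> `|a - c| <= eps / 2 ->
    `|c - b| <= eps.
  rewrite distrC => h1; rewrite distrC => h2.
  by rewrite (@ler_dist_half _ eps c b a a).
by split=> // [|j]; [exact: half gp gw|exact: half (dp j) (dw j)].
Qed.

(** With [u'] the point displaced by [h] along [e_i], the function [E] starts at 0 and ends at the
    error of the linear approximation. Closedness makes its derivative small compared with [h], and
    the mean value theorem on the unit interval carries this over to [E 1]. *)
Lemma is_derive_ray_integral (u : V) (i : 'I_N) : U u ->
  is_derive u (e_ i) (fun w => ray_integral w 1) (g i u).
Proof.
move=> Uu.
suff H : h^-1 *: (((fun w => ray_integral w 1) \o shift u) (h *: e_ i)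
    - ray_integral u 1) @[h --> 0^'] --> g i u.
  by split; [apply/cvg_ex; eexists; exact: H|exact/cvg_lim].
apply/cvgrPdist_le => eps eps0 /=.
pose x := u - u0.
(* The entries of [x] weight the errors of the [g j]; the added 1 pays for the separate term in
   [g i]. *)
pose C : R := \sum_j `|x 0 j| + 1.
have C0 : 0 < C by rewrite /C ltr_wpDl // sumr_ge0.
have eps'0 : 0 < eps / C by rewrite divr_gt0.
have [d d0 dP] := ray_tube i Uu eps'0.
near=> h.
have h0 : h != 0 by near: h; exact: nbhs_dnbhs_neq.
have hd : `|h| < d by near: h; exact: dnbhs0_lt.
pose u' := h *: e_ i + u.
have near_p (t s : R) : 0 <= s <= 1 ->
    `|(s * h) *: e_ i + (t *: x + u0) - (t *: x + u0)| < d.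
  move=> /andP[s0 s1]; rewrite addrK normrZ normrM (ger0_norm s0).
  apply: le_lt_trans hd; rewrite -[leRHS]mul1r -mulrA ler_pM ?mulr_ge0 //.
  by rewrite -[leRHS]mulr1 ler_wpM2l // normr_delta_mx.
have Ep' (t : R) : t *: (u' - u0) + u0 = (t * h) *: e_ i + (t *: x + u0).
  by rewrite /u' -addrA -/x scalerDr scalerA addrA.
have Ux (t : R) : 0 <= t <= 1 -> U (t *: x + u0) by exact: Ustar.
have Ux' (t : R) : 0 <= t <= 1 -> U (t *: (u' - u0) + u0).
  by move=> t01; rewrite Ep'; have [] := dP t _ t01 (near_p t t t01).
have [Q0 Qc Qd] := ray_integralP Ux.
have [Q'0 Q'c Q'd] := ray_integralP Ux'.
(* The expected variation of the integral up to [t]: by closedness, the derivative of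
   [t * g i (t *: x + u0)] in [t] is the derivative of the ray integrand in the [i]-th coordinate of
   [u]. *)
pose G (t : R) := h * (t * g i (t *: x + u0)).
pose dG (t : R) := h * (t * (\sum_j x 0 j * partial j (g i) (t *: x + u0))
                        + g i (t *: x + u0)).
have Gd (t : R) : 0 <= t <= 1 -> is_derive t (1 : R) G (dG t).
  move=> t01.
  have dg := smooth_is_derive_ray (sg i) (Ux t t01).
  have := @is_deriveZ _ _ _ (fun t : R => t * g i (t *: x + u0)) h t 1
    (t * (\sum_j x 0 j * partial j (g i) (t *: x + u0)) + g i (t *: x + u0)).
  apply.
  have := @is_deriveM _ _ id (fun s : R => g i (s *: x + u0)) t 1 1 _
    (is_derive_id _ _) dg.
  by move/is_derive_eq; apply; rewrite -[g i _ *: _]/(_ * _) mulr1.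
pose E := (ray_integral u' - ray_integral u - G).
pose dE t := ray_integrand u' t - ray_integrand u t - dG t.
have Ed (t : R) : t \in `]0, 1[ -> is_derive t 1 E (dE t).
  move=> /[!in_itv] /= t01.
  have t01' : 0 <= t <= 1 by case/andP : t01 => ? ?; rewrite !ltW.
  have d1 := @is_deriveB _ _ _ _ _ _ _ _ _ (Q'd t t01) (Qd t t01).
  exact: (@is_deriveB _ _ _ _ _ _ _ _ _ d1 (Gd t t01')).
have Ec : {within `[0, 1], continuous E}.
  have Gc : {within `[0, 1], continuous G}.
    apply: derivable_within_continuous => t /[!in_itv]/= t01.
    by have [] := Gd t t01.
  rewrite /E => t; apply: continuousB; last exact: Gc.
  by apply: continuousB; [exact: Q'c|exact: Qc].
have [t t01 Et] := MVT_segment (ler01 : 0 <= (1 : R)) Ed Ec.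
move: t01; rewrite in_itv /= => t01.
have E0 : E 0 = 0.
  by rewrite /E !fctE Q0 Q'0 /G mul0r mulr0 !subr0.
have E1 : E 1 = ray_integral u' 1 - ray_integral u 1 - h * g i u.
  by rewrite /E !fctE /G mul1r scale1r /x subrK.
have sumx (F : V -> V) :
    \sum_j (u' - u0) 0 j * g j (F u) = \sum_j x 0 j * g j (F u) + h * g i (F u).
  have -> : h * g i (F u) = \sum_j (h *: e_ i) 0 j * g j (F u).
    rewrite (bigD1 i) //= !mxE !eqxx /= mulr1 big1 ?addr0 // => j ji.
    by rewrite !mxE (negbTE ji) andbF mulr0 mul0r.
  rewrite -big_split; apply: eq_bigr => j _ /=; rewrite -mulrDl; congr (_ * _).
  by rewrite /u' /x !mxE; ring.
set p := t *: x + u0.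
set p' := (t * h) *: e_ i + p.
have dEt : dE t = \sum_j x 0 j * (g j p' - g j p - h * (t * partial i (g j) p))
    + h * (g i p' - g i p).
  rewrite /dE /ray_integrand Ep' -/x -/p -/p' (sumx (fun=> p')) /dG -/p.
  rewrite (_ : \sum_j x 0 j * partial j (g i) p =
      \sum_j x 0 j * partial i (g j) p); last first.
    by apply: eq_bigr => j _; rewrite (closed_g (Ux _ t01)).
  rewrite [RHS](_ : _ = \sum_j (x 0 j * g j p' - x 0 j * g j p
     - h * (t * (x 0 j * partial i (g j) p))) + h * (g i p' - g i p));
    last first.
    by congr (_ + _); apply: eq_bigr => j _; ring.
  by rewrite !sumrB -!mulr_sumr; ring.
have bound : `|dE t| <= `|h| * eps.
  rewrite dEt (_ : eps = C * (eps / C)); last by rewrite mulrC divfK ?gt_eqF.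
  rewrite {1}/C [X in _ <= _ * X]mulrDl mul1r [leRHS]mulrDr.
  apply: le_trans (ler_normD _ _) _.
  have [_ gip _] := dP t p' t01 (near_p t t t01).
  rewrite lerD //; last by rewrite normrM ler_wpM2l.
  rewrite mulr_suml mulr_sumr (le_trans (ler_norm_sum _ _ _)) //.
  apply: ler_sum => j _; rewrite normrM [leRHS]mulrCA ler_wpM2l //.
  (* The displacement from [p] to [p'] is [t * h] along [e_i], so the intermediate point stays in
     the tube with factor [s * t] in the unit interval. *)
  have [s s01 Es] : exists2 s : R, 0 <= s <= 1 & g j p' - g j p =
      (t * h) * 'D_(e_ i) (g j) ((s * (t * h)) *: e_ i + p).
    apply: mvt_line => s s01; rewrite mulrA.
    have st01 : 0 <= s * t <= 1.
      by case/andP : s01 => ? ?; case/andP : t01 => ? ?; rewrite mulr_ge0 //=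
        mulr_ile1.
    have [Us _ _] := dP t _ t01 (near_p t _ st01).
    by have [] := smooth_on_exist (sg j) Us.
  have st01 : 0 <= s * t <= 1.
    by case/andP : s01 => ? ?; case/andP : t01 => ? ?; rewrite mulr_ge0 //=
      mulr_ile1.
  have [_ _ /(_ j)] := dP t _ t01 (near_p t _ st01).
  rewrite Es mulrA -/(partial i (g j) _) => bnd.
  rewrite -/p in bnd.
  rewrite (_ : t * h * _ - _ = h * (t * (
      partial i (g j) ((s * t * h) *: e_ i + p) - partial i (g j) p)));
    last by ring.
  rewrite !normrM ler_wpM2l //; case/andP : t01 => t0 t1.
  by rewrite (ger0_norm t0) (le_trans _ bnd) // ler_piMl.
rewrite E0 !subr0 mulr1 E1 in Et.
rewrite distrC -(ler_pM2l (_ : 0 < `|h|)) ?normr_gt0 // -normrM mulrBr.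
rewrite -[_ *: _]/(_ * _) mulrA divff // mul1r.
by rewrite Et.
Unshelve. all: by end_near. Qed.

Lemma poincare : U u0 -> exists f : V -> R,
  [/\ smooth_on U f, f u0 = 0 &
      forall u, U u -> forall i, partial i f u = g i u].
Proof.
move=> Uu0; exists (fun w => ray_integral w 1).
have pE u i : U u -> partial i (fun w => ray_integral w 1) u = g i u.
  by move=> Uu; have [] := is_derive_ray_integral i Uu.
split=> [||u Uu i]; last exact: pE.
(* The partial derivatives are the smooth [g i]; the continuity still missing is deduced from
   theirs. *)
- apply: smooth_from_partials.
    move=> u Uu; have dn : \forall w \near u, forall i,
        derivable (fun w => ray_integral w 1) w (e_ i).
      have : \forall w \near u, U w by exact: open_nbhs_nbhs.
      by apply: filterS => w Uw i; have [] := is_derive_ray_integral i Uw.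
    split; last exact: (nbhs_singleton dn).
    apply: continuous_partial dn _ => i.
    have c : partials_exist_on U (partial i (fun w => ray_integral w 1)).
      apply: (partials_exist_eq_on Uo _ (smooth_on_exist (sg i))) => w.
      by rewrite inE => Uw; rewrite pE.
    by have [] := c u Uu.
  move=> i; apply: (smooth_on_eq Uo) (sg i) => w; rewrite inE => Uw.
  by rewrite pE.
- have Ut (t : R) : 0 <= t <= 1 -> U (t *: (u0 - u0) + u0).
    by rewrite subrr scaler0 add0r.
  have [Q0 Qc Qd] := ray_integralP Ut.
  (* The integrand is zero on the degenerate ray, and the mean value theorem replaces an evaluation
     of the integral. *)
  have [t _] : exists2 c : R, c \in `[0, 1]%R & ray_integral u0 1
      - ray_integral u0 0 = ray_integrand u0 c * (1 - 0).
    by apply: (@MVT_segment R (ray_integral u0)).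
  rewrite Q0 !subr0 mulr1 => ->; rewrite /ray_integrand big1 // => j _.
  by rewrite subrr mxE mul0r.
Qed.

End Poincare.

(** * Commuting linear Pfaffian systems *)

Section GeometricSeries.
Variables (R : realType) (v : nat -> R) (K : R).
Hypothesis vK : forall k, `|v k| <= K / 2 ^+ k.

(** The bound is the exact sum of [K / 2 ^+ k] for [n <= k < n + d]. The weaker bound without the
    subtracted term would not pass through the induction on [d]. *)
Lemma geometric_sum_dist n d :
  `|\sum_(k < n + d) v k - \sum_(k < n) v k|
    <= 2 * K / 2 ^+ n - 2 * K / 2 ^+ (n + d).
Proof.
elim: d => [|d IH]; first by rewrite addn0 !subrr normr0.
rewrite addnS big_ord_recr /= addrAC (le_trans (ler_normD _ _)) //.
apply: le_trans (lerD IH (vK _)) _.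
have -> : 2 * K / 2 ^+ (n + d).+1 = K / 2 ^+ (n + d).
  by rewrite exprS invfM mulrACA mulfV ?mul1r // pnatr_eq0.
by rewrite -mulrA mulr2n mulrDl !mul1r; lra.
Qed.

Lemma geometric_series_dist n :
  `|\sum_(k < n) v k - limn (series v)| <= 2 * K / 2 ^+ n.
Proof.
have K0 : 0 <= K by have := le_trans (normr_ge0 _) (vK 0); rewrite expr0 divr1.
have cv : cvgn (series v).
  apply: normed_cvg; apply: (@series_le_cvg _ _ (geometric K 2^-1)) => //=.
  - by move=> n0; rewrite mulr_ge0 // exprn_ge0.
  - by move=> n0; rewrite exprVn.
  - by apply: is_cvg_geometric_series; rewrite ger0_norm ?invf_lt1 ?ltr1n.
apply/ler_addgt0Pr => e e0.
have [m _ mP] : \forall m \near \oo, `|limn (series v) - series v m| <= e.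
  by move/cvgrPdist_le : cv; apply.
have := mP (n + m)%N (leq_addl _ _); rewrite /series /= big_mkord => h1.
have h2 := geometric_sum_dist n m.
have h3 : 0 <= 2 * K / 2 ^+ (n + m) by rewrite divr_ge0 ?mulr_ge0 ?exprn_ge0.
rewrite -(subrKA (\sum_(k < n + m) v k)) (le_trans (ler_normD _ _)) //.
rewrite lerD //; last by rewrite distrC.
by rewrite distrC (le_trans h2) // gerBl.
Qed.

End GeometricSeries.

Lemma exists_pow2_le (R : realType) (T e : R) : 0 < e ->
  exists n, T / 2 ^+ n <= e.
Proof.
move=> e0; exists (Num.bound (T / e)).
rewrite ler_pdivrMr ?exprn_gt0 // mulrC -ler_pdivrMr // ltW //.
exact: upper_nthrootP.
Qed.

(** * Continuity and derivatives of uniform limits *)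

Section UniformApproximation.
Variables (R : realType) (V : normedModType R) (U : set V).
Hypothesis Uo : open U.

Lemma uniform_approx_continuous (f : V -> R) u : U u ->
  (forall e, 0 < e -> exists2 phi : V -> R, {for u, continuous phi} &
     forall w, U w -> `|phi w - f w| <= e) ->
  {for u, continuous f}.
Proof.
move=> Uu H; suff : f @ nbhs u --> f u by [].
apply/cvgrPdist_le => e e0.
have e3 : 0 < e / 3 by rewrite divr_gt0.
have [phi phic phif] := H _ e3.
have cu : phi @ nbhs u --> phi u by exact: phic.
move/cvgrPdist_le : cu => /(_ _ e3) cu.
have : \forall w \near u, U w /\ `|phi u - phi w| <= e / 3.
  by apply: filterI cu; exact: open_nbhs_nbhs.
have tri (a b c d : R) : `|a - b| <= e / 3 -> `|c - d| <= e / 3 ->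
    `|a - c| <= e / 3 -> `|b - d| <= e.
  rewrite !ler_norml => /andP[? ?] /andP[? ?] /andP[? ?].
  by apply/andP; split; lra.
apply: filterS => w [Uw phiw]; exact: tri (phif u Uu) (phif w Uw) phiw.
Qed.

(** The mean value theorem makes the difference quotient of [phi] a value of its derivative near
    [u], hence close to [g u] by the approximation and the continuity of [g]. *)
Lemma uniform_approx_derive (f g : V -> R) (u v : V) : U u ->
  {for u, continuous g} ->
  (forall e, 0 < e -> exists phi : V -> R, forall w, U w ->
     [/\ derivable phi w v, `|phi w - f w| <= e & `|'D_v phi w - g w| <= e]) ->
  is_derive u v f (g u).
Proof.
move=> Uu gc H.
suff D : h^-1 *: ((f \o shift u) (h *: v) - f u) @[h --> 0^'] --> g u.
  by split; [apply/cvg_ex; eexists; exact: D|exact/cvg_lim].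
apply/cvgrPdist_le => eps eps0 /=.
have e4 : 0 < eps / 4 by rewrite divr_gt0.
have cu : g @ nbhs u --> g u by exact: gc.
move/cvgrPdist_le : cu => /(_ _ e4) cu.
have : \forall w \near u, U w /\ `|g u - g w| <= eps / 4.
  by apply: filterI cu; exact: open_nbhs_nbhs.
move/nbhs_normP => [r r0 rP].
have r0' : 0 < r := r0.
have v1 : 0 < `|v| + 1 by rewrite ltr_wpDl.
near=> h.
have h0 : h != 0 by near: h; exact: nbhs_dnbhs_neq.
have hn : 0 < `|h| by rewrite normr_gt0.
have hr : `|h| < r / (`|v| + 1).
  by near: h; apply: dnbhs0_lt; rewrite divr_gt0.
have inr (s : R) : 0 <= s <= 1 ->
    U ((s * h) *: v + u) /\ `|g u - g ((s * h) *: v + u)| <= eps / 4.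
  move=> /andP[s0 s1]; apply: rP; rewrite /ball_ /= opprD addrCA subrr addr0.
  rewrite normrN normrZ normrM (ger0_norm s0).
  rewrite ltr_pdivlMr // in hr; apply: le_lt_trans hr.
  rewrite ler_pM ?mulr_ge0 ?lerDl // ler_piMl //.
(* The approximant is chosen after [h], because the difference quotient divides its error by [h]. *)
pose e := Num.min (eps / 4) (eps / 4 * `|h|).
have e0 : 0 < e by rewrite lt_min e4 mulr_gt0.
have [phi phiP] := H e e0.
have [s s01 Es] : exists2 s : R, 0 <= s <= 1 &
    phi (h *: v + u) - phi u = h * 'D_v phi ((s * h) *: v + u).
  by apply: mvt_line => s /inr[Us _]; have [] := phiP _ Us.
have [Us gs] := inr s s01.
have [_ _ ds] := phiP _ Us.
have [_ pu _] := phiP _ Uu.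
have Uh : U (h *: v + u).
  by have [] := inr 1 _; rewrite ?lexx ?ler01 // mul1r.
have [_ ph _] := phiP _ Uh.
have ee1 : e <= eps / 4 by rewrite ge_min lexx.
have ee2 : e <= eps / 4 * `|h| by rewrite ge_min lexx orbT.
move: (le_trans pu ee2) (le_trans ph ee2) (le_trans ds ee1) => {}pu {}ph {}ds.
rewrite distrC -(ler_pM2l hn) -normrM mulrBr -[_ *: _]/(_ * _) mulrA divff //.
rewrite mul1r.
have -> : f (h *: v + u) - f u - h * g u =
    (f (h *: v + u) - phi (h *: v + u)) + (phi u - f u) +
    (h * ('D_v phi ((s * h) *: v + u) - g ((s * h) *: v + u)) +
     h * (g ((s * h) *: v + u) - g u)).
  rewrite -mulrDr subrKA mulrBr -Es.
  move: (f _) (f _) (phi _) (phi _) (h * _) => a b c d k; ring.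
apply: le_trans (ler_normD _ _) _.
have q1 : `|f (h *: v + u) - phi (h *: v + u) + (phi u - f u)| <=
    eps / 4 * `|h| + eps / 4 * `|h|.
  by apply: le_trans (ler_normD _ _) _; rewrite lerD // distrC.
have q2 : `|h * ('D_v phi ((s * h) *: v + u) - g ((s * h) *: v + u)) +
    h * (g ((s * h) *: v + u) - g u)| <= `|h| * (eps / 4) + `|h| * (eps / 4).
  apply: le_trans (ler_normD _ _) _.
  by rewrite !normrM lerD // ler_wpM2l // distrC.
apply: le_trans (lerD q1 q2) _.
clear -eps; move: `|h| => k; lra.
Unshelve. all: by end_near. Qed.

End UniformApproximation.

Lemma continuous_sum_at (R : realType) (V : normedModType R) (I : Type)
    (s : seq I) (f : I -> V -> R) (u : V) :
  (forall i, {for u, continuous (f i)}) ->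
  {for u, continuous (fun w => \sum_(i <- s) f i w)}.
Proof.
move=> fc; elim: s => [|i s IH].
  rewrite (_ : (fun _ => _) = fun=> 0); first exact: cst_continuous.
  by apply/funext => w; rewrite big_nil.
rewrite (_ : (fun _ => _) = f i \+ (fun w => \sum_(i <- s) f i w)).
  exact: continuousD (fc i) IH.
by apply/funext => w; rewrite big_cons.
Qed.

(** * Iterated integration of a linear Pfaffian system *)

Section Pfaffian.
Variables (R : realType) (N M : nat).
Notation V := 'rV[R]_N.
Notation e_ i := (delta_mx 0 i : 'rV[R]_N).
Variable Om : 'I_N -> V -> 'M[R]_M.

Definition pfaff (y : 'I_M -> V -> R) (j : 'I_N) (a : 'I_M) (u : V) : R :=
  \sum_b Om j u a b * y b u.

Lemma pfaff_bound (C B : R) (y : 'I_M -> V -> R) j a u :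
  (forall a b, `|Om j u a b| <= C) -> (forall b, `|y b u| <= B) ->
  `|pfaff y j a u| <= M%:R * (C * B).
Proof.
move=> OC yB; apply: le_trans (ler_norm_sum _ _ _) _.
apply: (@le_trans _ _ (\sum_(b < M) C * B)).
  by apply: ler_sum => b _; rewrite normrM ler_pM.
by rewrite sumr_const card_ord mulr_natl.
Qed.

Section Star.
Variables (U : set V) (u0 : V) (rho C : R).
Hypothesis Uo : open U.
Hypothesis Uu0 : U u0.
Hypothesis Ustar : forall u (t : R), U u -> 0 <= t <= 1 ->
  U (t *: (u - u0) + u0).
Hypothesis Urho : forall u, U u -> `|u - u0| <= rho.
Hypothesis OC : forall u, U u -> forall j a b, `|Om j u a b| <= C.
Hypothesis small : N%:R * (rho * (M%:R * C)) <= 2^-1.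
Hypothesis sOm : forall j a b, smooth_on U (fun u => Om j u a b).
Hypothesis closed_Om : forall u, U u -> forall i j a b,
  partial i (fun w => Om j w a b) u = partial j (fun w => Om i w a b) u.
Hypothesis comm_Om : forall u, U u -> forall i j,
  Om i u *m Om j u = Om j u *m Om i u.

Lemma smooth_pfaff (y : 'I_M -> V -> R) j a :
  (forall b, smooth_on U (y b)) -> smooth_on U (pfaff y j a).
Proof.
move=> sy.
apply: (@smooth_on_sum _ _ U Uo _ _ _ (fun b u => Om j u a b * y b u)).
by move=> b; exact: (smooth_onM Uo (sOm j a b) (sy b)).
Qed.

Lemma partial_pfaff (y : 'I_M -> V -> R) i j a u :
  (forall b, smooth_on U (y b)) -> U u ->
  partial i (pfaff y j a) u =
  \sum_b partial i (fun w => Om j w a b) u * y b u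
  + \sum_b Om j u a b * partial i (y b) u.
Proof.
move=> sy Uu.
have sp b := smooth_on_exist (smooth_onM Uo (sOm j a b) (sy b)).
rewrite /pfaff (partial_sum _ _ sp Uu) -big_split /=.
apply: eq_bigr => b _.
exact: (partialM i (smooth_on_exist (sOm j a b)) (smooth_on_exist (sy b)) Uu).
Qed.

(** The state kept along the iteration: what the Poincare lemma needs in order to produce the next
    term. *)
Definition compatible (y : 'I_M -> V -> R) :=
  (forall b, smooth_on U (y b)) /\ (forall u, U u -> forall i j a,
    partial i (pfaff y j a) u = partial j (pfaff y i a) u).

Lemma compatible_cst (y0 : 'I_M -> R) : compatible (fun b _ => y0 b).
Proof.
have sy b : smooth_on U (fun=> y0 b) := @smooth_on_cst _ _ U _ (y0 b).
split=> [|u Uu i j a]; first exact: sy.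
rewrite (partial_pfaff i j a sy Uu) (partial_pfaff j i a sy Uu); congr (_ + _).
  by apply: eq_bigr => b _; rewrite closed_Om.
by apply: eq_bigr => b _; rewrite !partial_cst !mulr0.
Qed.

(** The derivative of [pfaff z j a] has two parts. One is symmetric in the two directions because
    [Om] is closed. In the other, the equation for [z] produces a product of two coefficient
    matrices acting on [y], symmetric because they commute. *)
Lemma compatible_step (y : 'I_M -> V -> R) : compatible y ->
  exists2 z, compatible z & forall a, z a u0 = 0 /\
    forall u, U u -> forall j, partial j (z a) u = pfaff y j a u.
Proof.
move=> [sy cy].
have /choice[z zP] a : exists f : V -> R, [/\ smooth_on U f, f u0 = 0 &
    forall u, U u -> forall i, partial i f u = pfaff y i a u].
  apply: (poincare Uo Ustar _ _ Uu0) => [i|u Uu i j]; last exact: cy.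
  exact: smooth_pfaff.
have sz b : smooth_on U (z b) by have [] := zP b.
exists z; last by move=> a; have [_ ? ?] := zP a.
split=> [|u Uu i j a]; first exact: sz.
rewrite (partial_pfaff i j a sz Uu) (partial_pfaff j i a sz Uu); congr (_ + _).
  by apply: eq_bigr => b _; rewrite closed_Om.
have E k l : \sum_b Om k u a b * partial l (z b) u =
    \sum_c (Om k u *m Om l u) a c * y c u.
  transitivity (\sum_b \sum_c Om k u a b * Om l u b c * y c u).
    apply: eq_bigr => b _; have [_ _ /(_ u Uu l) ->] := zP b.
    by rewrite /pfaff mulr_sumr; apply: eq_bigr => c _; rewrite mulrA.
  rewrite exchange_big /=; apply: eq_bigr => c _.
  by rewrite mxE mulr_suml.
by rewrite !E (comm_Om Uu i j).
Qed.

(** Compatibility travels inside a sigma type, so that [choice] gives a single step function which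
    can be iterated. *)
Lemma compatible_sequence (y0 : 'I_M -> R) :
  exists Y : nat -> 'I_M -> V -> R,
    [/\ Y 0%N = fun b _ => y0 b, forall n, compatible (Y n) &
        forall n a, Y n.+1 a u0 = 0 /\ forall u, U u -> forall j,
          partial j (Y n.+1 a) u = pfaff (Y n) j a u].
Proof.
have /choice[F FP] (y : {y | compatible y}) : exists z : {z | compatible z},
    forall a, sval z a u0 = 0 /\
      forall u, U u -> forall j, partial j (sval z a) u = pfaff (sval y) j a u.
  have [z cz zP] := compatible_step (svalP y).
  by exists (exist _ z cz); exact: zP.
exists (fun n => sval (iter n F (exist _ _ (compatible_cst y0))));
  split; first by [].
  by move=> n; exact: svalP.
by move=> n a; exact: FP.
Qed.

(** Each integration along a ray costs a factor of at most [N * rho * M * C], from the [N]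
    coordinates of the ray and the [M] terms of a matrix product. By [small] it is at most one half,
    so the terms decay geometrically. *)
Lemma pfaffian_star (y0 : 'I_M -> R) : exists y : 'I_M -> V -> R,
  [/\ forall a, smooth_on U (y a), forall a, y a u0 = y0 a &
      forall u, U u -> forall j a, partial j (y a) u = pfaff y j a u].
Proof.
have [Y [Y0 cY stepY]] := compatible_sequence y0.
have sY n a : smooth_on U (Y n a) by have [] := cY n.
pose K := \big[Num.max/0]_a `|y0 a|.
have K0 : 0 <= K by exact: bigmax_ge_id.
(* The sign of [C] is read off an entry of [Om], so indices must be at hand. *)
have C0 (j : 'I_N) (a : 'I_M) : 0 <= C.
  exact: le_trans (normr_ge0 _) (OC Uu0 j a a).
(* All terms after the zeroth vanish at [u0], so the mean value along the ray bounds them by their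
   derivatives. *)
have YK n a u : U u -> `|Y n a u| <= K / 2 ^+ n.
  elim: n a u => [|n IH] a u Uu.
    by rewrite Y0 expr0 divr1; exact: le_bigmax.
  have [Yu0 dY] := stepY n a.
  have [t t01] := mean_value_ray Uo (x := u - u0) (z := u0) (sY n.+1 a)
    (fun t => Ustar Uu).
  rewrite subrK Yu0 subr0 => ->.
  have Ut := Ustar Uu t01.
  apply: le_trans (ler_norm_sum _ _ _) _.
  apply: (@le_trans _ _ (\sum_(j < N) rho * (M%:R * (C * (K / 2 ^+ n))))).
    apply: ler_sum => j _; rewrite normrM ler_pM //.
      exact: le_trans (ler_normr_coord _ _) (Urho Uu).
    by rewrite dY //; apply: pfaff_bound => b; [exact: OC|exact: IH].
  rewrite sumr_const card_ord -[leLHS]mulr_natl.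
  have -> : K / 2 ^+ n.+1 = 2^-1 * (K / 2 ^+ n) by rewrite exprS invfM mulrCA.
  set Q := K / 2 ^+ n.
  have -> : N%:R * (rho * (M%:R * (C * Q))) = N%:R * (rho * (M%:R * C)) * Q.
    by rewrite -!mulrA.
  by rewrite ler_wpM2r // divr_ge0 // exprn_ge0.
pose S n a u := \sum_(k < n) Y k a u.
pose y a u := limn (series (fun k => Y k a u)).
have Sy n a u : U u -> `|S n a u - y a u| <= 2 * K / 2 ^+ n.
  by move=> Uu; apply: geometric_series_dist => k; exact: YK.
have sS n a : smooth_on U (S n a).
  exact: (@smooth_on_sum _ _ U Uo _ _ _ (fun (k : 'I_n) u => Y k a u)).
(* The index shift comes from the constant zeroth term: every later term has its predecessor as
   source. *)
have dS n j a u : U u -> partial j (S n.+1 a) u = pfaff (S n) j a u.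
  move=> Uu; have eY (k : 'I_n.+1) := smooth_on_exist (sY k a).
  rewrite /S (partial_sum _ _ eY Uu).
  rewrite big_ord_recl /= Y0 partial_cst add0r /pfaff.
  under [RHS]eq_bigr do rewrite mulr_sumr.
  rewrite exchange_big /=; apply: eq_bigr => k _.
  by have [_ ->] := stepY k a.
have yc a u : U u -> {for u, continuous (y a)}.
  move=> Uu; apply: (uniform_approx_continuous Uo Uu) => e e0.
  have [n nP] := exists_pow2_le (2 * K) e0.
  exists (S n a); first by have [] := smooth_on_exist (sS n a) Uu.
  by move=> w Uw; exact: le_trans (Sy n a w Uw) nP.
have pyc j a u : U u -> {for u, continuous (pfaff y j a)}.
  move=> Uu; apply: continuous_sum_at => b.
  apply: (@continuousM _ _ (fun w => Om j w a b) (y b)); last exact: yc.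
  by have [] := smooth_on_exist (sOm j a b) Uu.
have dy j a u : U u -> is_derive u (e_ j) (y a) (pfaff y j a u).
  move=> Uu; apply: (uniform_approx_derive Uo Uu (pyc j a u Uu)) => e e0.
  (* One constant for two errors: the summand 1 serves the values, [M%:R * C] the derivatives. *)
  have [n nP] := exists_pow2_le (2 * K * (1 + M%:R * C)) e0.
  have MC0 : 0 <= M%:R * C by rewrite mulr_ge0 // C0.
  have n1 : 2 * K / 2 ^+ n <= e.
    apply: le_trans nP; rewrite ler_wpM2r ?invr_ge0 ?exprn_ge0 //.
    by rewrite ler_peMr ?mulr_ge0 // lerDl.
  exists (S n.+1 a) => w Uw; split.
  - by have [] := smooth_on_exist (sS n.+1 a) Uw.
  - apply: le_trans (Sy _ _ _ Uw) (le_trans _ n1).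
    rewrite ler_wpM2l ?mulr_ge0 // lef_pV2 ?posrE ?exprn_gt0 //.
    by rewrite ler_weXn2l ?ler1n.
  - rewrite -/(partial j (S n.+1 a) w) dS //.
    have -> : pfaff (S n) j a w - pfaff y j a w =
        pfaff (fun b w => S n b w - y b w) j a w.
      by rewrite /pfaff -sumrB; apply: eq_bigr => b _; rewrite mulrBr.
    apply: le_trans (pfaff_bound (C := C) (B := 2 * K / 2 ^+ n) _ _ _) _.
    + by move=> a' b; exact: OC.
    + by move=> b; exact: Sy.
    have -> : M%:R * (C * (2 * K / 2 ^+ n)) = 2 * K * (M%:R * C) / 2 ^+ n.
      by move: (2 ^+ n)^-1 => q; ring.
    apply: le_trans nP; rewrite ler_wpM2r ?invr_ge0 ?exprn_ge0 //.
    by rewrite ler_wpM2l ?mulr_ge0 // lerDr.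
have ey a : partials_exist_on U (y a).
  by move=> u Uu; split=> [|j]; [exact: yc|have [] := dy j a u Uu].
have py u j a : U u -> partial j (y a) u = pfaff y j a u.
  by move=> Uu; have [] := dy j a u Uu.
(* Bootstrapping: the equation writes the derivatives of [y] through [y] itself, so each order of
   regularity gives the next. *)
have cky n : forall a, ck_on U n (y a).
  elim: n => [|n IH] a; first by split; first exact: ey.
  split=> [|j]; first exact: ey.
  apply: (ck_eq_on Uo (f := pfaff y j a)).
    by move=> u; rewrite inE => Uu; rewrite py.
  apply: (@ck_on_sum _ _ U Uo _ _ _ _ (fun b u => Om j u a b * y b u)) => b.
  apply: (ck_onM Uo); last exact: IH.
  by have /smooth_onP := sOm j a b; exact.
exists y; split.
- by move=> a; apply/smooth_onP => n; exact: cky.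
- move=> a; rewrite /y.
  suff -> : (fun k => Y k a u0) = (fun k => (k == 0%N)%:R * y0 a).
    apply/cvg_lim => //; apply: cvg_near_cst; exists 1%N => // n /= n1.
    rewrite /series /= big_mkord; case: n n1 => // n _.
    by rewrite big_ord_recl /= mul1r big1 ?addr0 // => k _; rewrite mul0r.
  apply/funext => -[|k]; first by rewrite Y0 mul1r.
  by have [-> _] := stepY k a; rewrite mul0r.
- by move=> u Uu j a; exact: py.
Qed.

End Star.

(** By linearity the radius depends on the coefficients only. Hence [U] is chosen before the initial
    value, and one [U] will serve all columns of a frame. *)
Lemma pfaffian_local (W : set V) (u0 : V) :
  open W -> W u0 ->
  (forall j a b, smooth_on W (fun u => Om j u a b)) ->
  (forall u, W u -> forall i j a b,
    partial i (fun w => Om j w a b) u = partial j (fun w => Om i w a b) u) ->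
  (forall u, W u -> forall i j, Om i u *m Om j u = Om j u *m Om i u) ->
  exists U : set V, [/\ open U, U u0, U `<=` W,
    forall u (t : R), U u -> 0 <= t <= 1 -> U (t *: (u - u0) + u0) &
    forall y0 : 'I_M -> R, exists y : 'I_M -> V -> R,
      [/\ forall a, smooth_on U (y a), forall a, y a u0 = y0 a &
          forall u, U u -> forall j a, partial j (y a) u = pfaff y j a u]].
Proof.
move=> Wo Wu0 sOm cOm mOm.
pose T := ('I_N * 'I_M * 'I_M)%type.
(* The largest entry at [u0], plus 1 for the variation allowed on the ball. *)
pose C : R := \big[Num.max/0]_(t : T) `|Om t.1.1 u0 t.1.2 t.2| + 1.
have C0 : 0 < C by rewrite ltr_wpDl //; exact: bigmax_ge_id.
have near_Om (t : T) : \forall w \near u0,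
    `|Om t.1.1 u0 t.1.2 t.2 - Om t.1.1 w t.1.2 t.2| <= 1.
  have c : (fun w => Om t.1.1 w t.1.2 t.2) @ nbhs u0 --> Om t.1.1 u0 t.1.2 t.2.
    by have [] := smooth_on_exist (sOm t.1.1 t.1.2 t.2) Wu0.
  by move/cvgrPdist_le : c => /(_ _ ltr01).
have : \forall w \near u0, W w /\
    forall t : T, `|Om t.1.1 u0 t.1.2 t.2 - Om t.1.1 w t.1.2 t.2| <= 1.
  apply: filterI; first exact: open_nbhs_nbhs.
  exact: (@filter_forall _ _ (fun (t : T) w =>
    `|Om t.1.1 u0 t.1.2 t.2 - Om t.1.1 w t.1.2 t.2| <= 1) (nbhs u0) _ near_Om).
move/nbhs_normP => [r r0 rP].
(* A radius of at most [D^-1] gives the factor one half; the added 1 keeps [D] positive when [N] or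
   [M] is 0. *)
pose D : R := N%:R * (M%:R * C) * 2 + 1.
have NMC0 : 0 <= N%:R * (M%:R * C) by rewrite !mulr_ge0 // ltW.
have D0 : 0 < D by rewrite ltr_wpDl // mulr_ge0.
pose rho := Num.min r D^-1.
have rho0 : 0 < rho by rewrite lt_min r0 invr_gt0.
have Ur u : ball u0 rho u -> `|u0 - u| < r.
  by rewrite -ball_normE /= => h; rewrite (lt_le_trans h) // ge_min lexx.
have Us u (t : R) : ball u0 rho u -> 0 <= t <= 1 ->
    ball u0 rho (t *: (u - u0) + u0).
  rewrite -!ball_normE /= opprD addrCA subrr addr0 normrN normrZ distrC.
  move=> h /andP[t0 t1]; rewrite ger0_norm //; apply: le_lt_trans h.
  by rewrite ler_piMl.
exists (ball u0 rho); split.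
- exact: ball_open.
- exact: ballxx.
- by move=> u /Ur/rP[].
- exact: Us.
have Uo : open (ball u0 rho) by exact: ball_open.
have UW : ball u0 rho `<=` W by move=> u /Ur/rP[].
apply: (@pfaffian_star (ball u0 rho) u0 rho C Uo).
- exact: ballxx.
- exact: Us.
- by move=> u; rewrite -ball_normE /= distrC => /ltW.
- move=> u /Ur/rP[_ H] j a b; have := H (j, a, b); rewrite /= => h.
  have h0 : `|Om j u0 a b| <= \big[Num.max/0]_(t : T) `|Om t.1.1 u0 t.1.2 t.2|.
    exact: (le_bigmax _ (fun t : T => `|Om t.1.1 u0 t.1.2 t.2|) (j, a, b)).
  rewrite -[Om j u a b](subrK (Om j u0 a b)) (le_trans (ler_normD _ _)) //.
  by rewrite addrC /C lerD // distrC.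
- rewrite mulrCA; apply: (@le_trans _ _ (D^-1 * (N%:R * (M%:R * C)))).
    by rewrite ler_wpM2r // ge_min lexx orbT.
  rewrite mulrC ler_pdivrMr // /D [leRHS]mulrDr mulr1 [X in _ <= X + _]mulrC.
  by rewrite mulfK ?pnatr_eq0 // lerDl.
- by move=> j a b; exact: smooth_onS UW (sOm j a b).
- by move=> u /UW Wu; exact: cOm.
- by move=> u /UW Wu; exact: mOm.
Qed.

End Pfaffian.

(** * Congruence of forms of equal signature *)

Section Signature.
Variable R : realType.

Lemma card_set_ord n (P : pred 'I_n) : #|[set i | P i]%SET| = (\sum_i P i)%N.
Proof.
rewrite -sum1_card big_mkcond; apply: eq_bigr => i _.
by rewrite inE; case: (P i).
Qed.

Lemma has_signature_block m n (A : 'M[R]_m) (B : 'M[R]_n) a b a' b' :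
  has_signature A a b -> has_signature B a' b' ->
  has_signature (block_mx A 0 0 B) (a + a') (b + b').
Proof.
move=> [P [d [Pu PA dp dn]]] [Q [e [Qu QB ep en]]].
exists (block_mx P 0 0 Q), (row_mx d e); split.
- by rewrite unitmxE det_ublock unitrM -!unitmxE Pu Qu.
- rewrite tr_block_mx !trmx0 !mulmx_block !(mulmx0, mul0mx, addr0, add0r).
  by rewrite PA QB diag_mx_row.
- rewrite card_set_ord big_split_ord /= -dp -ep !card_set_ord.
  by congr (_ + _)%N; apply: eq_bigr => i _; rewrite ?row_mxEl ?row_mxEr.
- rewrite card_set_ord big_split_ord /= -dn -en !card_set_ord.
  by congr (_ + _)%N; apply: eq_bigr => i _; rewrite ?row_mxEl ?row_mxEr.
Qed.

Lemma has_signature_diag n (A : 'M[R]_n) a b : A \in unitmx ->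
  has_signature A a b -> exists (P : 'M[R]_n) (d : 'rV[R]_n),
    [/\ P \in unitmx, P *m A *m P^T = diag_mx d,
        forall i, d 0 i != 0 & #|[set i | 0 < d 0 i]%SET| = a].
Proof.
move=> Au [P [d [Pu PA dp dn]]]; exists P, d; split=> // i.
have : diag_mx d \in unitmx by rewrite -PA !unitmx_mul Pu Au unitmx_tr Pu.
rewrite unitmxE det_diag unitfE prodf_seq_neq0 => /allP/(_ i).
by rewrite mem_index_enum; exact.
Qed.

(** List [A] and then its complement, and likewise for [B]; each element goes to the one at the same
    position of the other list. *)
Lemma bijection_of_card (T : finType) (A B : {set T}) : #|A| = #|B| ->
  exists2 f : T -> T, injective f & forall x, (f x \in B) = (x \in A).
Proof.
move=> cAB.
pose sA := enum A ++ enum (~: A)%SET; pose sB := enum B ++ enum (~: B)%SET.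
have uniq_s (C : {set T}) : uniq (enum C ++ enum (~: C)%SET).
  rewrite cat_uniq !enum_uniq andbT /=; apply/hasPn => x.
  by rewrite !mem_enum inE.
have mem_s (C : {set T}) x : x \in enum C ++ enum (~: C)%SET.
  by rewrite mem_cat !mem_enum inE orbN.
have size_s (C : {set T}) : size (enum C ++ enum (~: C)%SET) = #|T|.
  by rewrite size_cat -!cardE cardsC.
have lt_s x : (index x sA < size sB)%N.
  by rewrite size_s -(size_s A) index_mem mem_s.
exists (fun x => nth x sB (index x sA)) => [x y|x].
  rewrite (set_nth_default y x) ?lt_s // => /eqP.
  rewrite nth_uniq ?lt_s ?uniq_s // => /eqP h.
  by rewrite -(nth_index y (mem_s A x)) -/sA h nth_index ?mem_s.
have sizeAB : size (enum A) = size (enum B) by rewrite -!cardE.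
case: (boolP (x \in A)) => xA; rewrite /sB nth_cat /sA index_cat mem_enum.
  rewrite xA -sizeAB index_mem mem_enum xA -[_ \in B]mem_enum mem_nth //.
  by rewrite -sizeAB index_mem mem_enum.
rewrite (negbTE xA) -sizeAB ltnNge leq_addr /= addnC addnK; apply/negbTE.
suff : nth x (enum (~: B)%SET) (index x (enum (~: A)%SET)) \in enum (~: B)%SET.
  by rewrite mem_enum inE.
rewrite mem_nth // -cardE -(eqP (_ : #|~: A|%SET == #|~: B|%SET)).
  by rewrite cardE index_mem mem_enum inE xA.
by rewrite -(eqn_add2l #|A|) cardsC cAB cardsC.
Qed.

(** After diagonalisation all entries are nonzero, so equal numbers of positive ones allow a
    permutation [f] matching signs. Rescaling by square roots of the positive ratios
    [e 0 i / d 0 (f i)] then carries one diagonal form to the other. *)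
Lemma congruent_of_signature n (A C : 'M[R]_n) a b :
  A \in unitmx -> C \in unitmx ->
  has_signature A a b -> has_signature C a b ->
  exists X : 'M[R]_n, X *m A *m X^T = C.
Proof.
move=> Au Cu /(has_signature_diag Au)[P [d [Pu PA d0 da]]].
move=> /(has_signature_diag Cu)[Q [e [Qu QC e0 ea]]].
have [f finj fP] := bijection_of_card (etrans ea (esym da)).
have sgn i : 0 < e 0 i / d 0 (f i).
  have := fP i; rewrite !inE; have := d0 (f i); have := e0 i.
  rewrite !neq_lt => /orP[en|ep] /orP[dn|dp].
  - by move=> _; rewrite nmulr_rgt0 ?invr_lt0.
  - by rewrite dp (lt_gtF en).
  - by rewrite ep (lt_gtF dn).
  - by move=> _; rewrite divr_gt0.
pose X : 'M[R]_n :=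
  \matrix_(i, j) ((j == f i)%:R * Num.sqrt (e 0 i / d 0 (f i))).
have XdX : X *m diag_mx d *m X^T = diag_mx e.
  apply/matrixP => i l; rewrite mxE (bigD1 (f i)) //= big1 ?addr0; last first.
    by move=> j jf; rewrite mul_mx_diag !mxE (negbTE jf) !mul0r.
  rewrite mul_mx_diag !mxE eqxx mul1r (inj_eq finj).
  have [->|_] := eqVneq i l; last by rewrite mul0r mulr0 mulr0n.
  by rewrite mul1r mulrAC -expr2 sqr_sqrtr ?(ltW (sgn l)) // divfK.
exists (invmx Q *m X *m P).
rewrite !trmx_mul trmx_inv.
have -> : invmx Q *m X *m P *m A *m (P^T *m (X^T *m invmx Q^T)) =
  invmx Q *m (X *m (P *m A *m P^T) *m X^T) *m invmx Q^T by rewrite !mulmxA.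
by rewrite PA XdX -QC !mulmxA mulVmx // mul1mx mulmxK // unitmx_tr.
Qed.

End Signature.

(** * Normal indices arranged in [k] blocks of length [N] *)

Section BlockIndex.
Variables (N k p : nat) (hN : (0 < N)%N) (hk : (0 < k)%N).

(** The position inside a block when [al < k * N]; for larger indices a value without meaning, which
    keeps the function total. *)
Definition block_pos (al : 'I_(k * N + p)) : 'I_N :=
  Ordinal (ltn_pmod al hN).

Lemma block_pos_index (s : 'I_k) (m : 'I_N) :
  block_pos (block_index p s m) = m.
Proof. by apply: val_inj; rewrite /= modnMDl modn_small. Qed.

Lemma block_index_lt (s : 'I_k) (m : 'I_N) : (block_index p s m < k * N)%N.
Proof.
rewrite /=; apply: (@leq_trans (s * N + N)); first by rewrite ltn_add2l.
by rewrite addnC -mulSn leq_mul2r ltn_ord orbT.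
Qed.

Lemma block_indexP (al : 'I_(k * N + p)) : (al < k * N)%N ->
  exists s, al = block_index p s (block_pos al).
Proof.
move=> lt; have ltk : (al %/ N < k)%N by rewrite ltn_divLR.
by exists (Ordinal ltk); apply: val_inj; rewrite /= -divn_eq.
Qed.

Lemma sum_block_index (R : nmodType) (f : 'I_(k * N + p) -> R) :
  (forall al : 'I_(k * N + p), (k * N <= al)%N -> f al = 0) ->
  \sum_al f al = \sum_(s < k) \sum_(m < N) f (block_index p s m).
Proof.
move=> f0; rewrite pair_bigA /=.
rewrite (bigID (fun al : 'I_(k * N + p) => al < k * N)%N) /= addrC big1 ?add0r;
  last by move=> al; rewrite -leqNgt; exact: f0.
(* The remainder modulo [k] only makes the inverse total: below [k * N] the quotient is already less
   than [k]. *)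
pose h (al : 'I_(k * N + p)) : 'I_k * 'I_N :=
  (Ordinal (ltn_pmod (al %/ N) hk), block_pos al).
rewrite (reindex (fun sm : 'I_k * 'I_N => block_index p sm.1 sm.2)) /=;
  last first.
  exists h => [[s m] _|al].
    rewrite /h block_pos_index; congr (_, _); apply: val_inj => /=.
    by rewrite divnMDl // divn_small // addn0 modn_small.
  rewrite inE => lt; apply: val_inj => /=.
  by rewrite modn_small ?ltn_divLR // -divn_eq.
by apply: eq_bigl => sm; rewrite -[LHS]/(block_index p sm.1 sm.2 < k * N)%N
  block_index_lt.
Qed.

End BlockIndex.

(** * Calculus of matrix-valued functions *)

Section MatrixCalculus.
Variables (R : realType) (N : nat) (U : set 'rV[R]_N).
Hypothesis Uo : open U.
Notation V := 'rV[R]_N.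

Lemma smooth_on_mulmx m n q (X : V -> 'M[R]_(m, n)) (Y : V -> 'M[R]_(n, q)) :
  smooth_on U X -> smooth_on U Y -> smooth_on U (fun w => X w *m Y w).
Proof.
move=> /(smooth_on_mxP Uo) sX /(smooth_on_mxP Uo) sY.
apply/(smooth_on_mxP Uo) => a b.
rewrite (_ : (fun _ => _) = fun w => \sum_c X w a c * Y w c b); last first.
  by apply/funext => w; rewrite mxE.
apply: (@smooth_on_sum _ _ U Uo _ _ _ (fun c w => X w a c * Y w c b)) => c.
exact: smooth_onM (sX a c) (sY c b).
Qed.

Lemma partial_mulmx m n q (X : V -> 'M[R]_(m, n)) (Y : V -> 'M[R]_(n, q))
    i u : smooth_on U X -> smooth_on U Y -> U u ->
  partial i (fun w => X w *m Y w) u =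
  partial i X u *m Y u + X u *m partial i Y u.
Proof.
move=> sX sY Uu.
have eX := smooth_on_exist sX; have eY := smooth_on_exist sY.
have /(smooth_on_mxP Uo) sX' := sX; have /(smooth_on_mxP Uo) sY' := sY.
apply/matrixP => a b.
rewrite (partial_mx i a b (smooth_on_exist (smooth_on_mulmx sX sY)) Uu).
rewrite (_ : (fun _ => _) = fun w => \sum_c X w a c * Y w c b); last first.
  by apply/funext => w; rewrite mxE.
have sXY c := smooth_on_exist (smooth_onM Uo (sX' a c) (sY' c b)).
rewrite (partial_sum _ _ sXY Uu) !mxE -big_split; apply: eq_bigr => c _ /=.
rewrite (partialM i (smooth_on_exist (sX' a c)) (smooth_on_exist (sY' c b)) Uu).
by rewrite (partial_mx i a c eX Uu) (partial_mx i c b eY Uu).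
Qed.

Lemma smooth_on_trmx m n (X : V -> 'M[R]_(m, n)) :
  smooth_on U X -> smooth_on U (fun w => (X w)^T).
Proof.
move=> /(smooth_on_mxP Uo) sX; apply/(smooth_on_mxP Uo) => a b.
by under eq_fun do rewrite mxE; exact: sX.
Qed.

Lemma partial_trmx m n (X : V -> 'M[R]_(m, n)) i u :
  smooth_on U X -> U u -> partial i (fun w => (X w)^T) u = (partial i X u)^T.
Proof.
move=> sX Uu; apply/matrixP => a b.
rewrite (partial_mx i a b (smooth_on_exist (smooth_on_trmx sX)) Uu) mxE.
rewrite (partial_mx i b a (smooth_on_exist sX) Uu).
by under eq_fun do rewrite mxE.
Qed.

Lemma smooth_on_oppmx m n (X : V -> 'M[R]_(m, n)) :
  smooth_on U X -> smooth_on U (fun w => - X w).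
Proof.
move=> sX; rewrite (_ : (fun _ => _) = fun w => (- 1%:M) *m X w).
  exact: smooth_on_mulmx (@smooth_on_cst _ _ U _ _) sX.
by apply/funext => w; rewrite mulNmx mul1mx.
Qed.

Lemma partial_oppmx m n (X : V -> 'M[R]_(m, n)) i u :
  smooth_on U X -> U u -> partial i (fun w => - X w) u = - partial i X u.
Proof.
by move=> sX Uu; apply: deriveN; have [] := smooth_on_exist sX Uu.
Qed.

Lemma partial_mulmx_cst m n q (X : V -> 'M[R]_(m, n)) (C : 'M[R]_(n, q)) i u :
  smooth_on U X -> U u ->
  partial i (fun w => X w *m C) u = partial i X u *m C.
Proof.
move=> sX Uu; rewrite (partial_mulmx i sX (@smooth_on_cst _ _ U _ C) Uu).
by rewrite partial_cst mulmx0 addr0.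
Qed.

Lemma smooth_on_block m1 m2 n1 n2 (X1 : V -> 'M[R]_(m1, n1))
    (X2 : V -> 'M[R]_(m1, n2)) (X3 : V -> 'M[R]_(m2, n1))
    (X4 : V -> 'M[R]_(m2, n2)) :
  smooth_on U X1 -> smooth_on U X2 -> smooth_on U X3 -> smooth_on U X4 ->
  smooth_on U (fun w => block_mx (X1 w) (X2 w) (X3 w) (X4 w)).
Proof.
move=> /(smooth_on_mxP Uo) s1 /(smooth_on_mxP Uo) s2 /(smooth_on_mxP Uo) s3.
move=> /(smooth_on_mxP Uo) s4; apply/(smooth_on_mxP Uo) => a b.
case: (split_ordP a) => i ->; case: (split_ordP b) => j ->.
- by under eq_fun do rewrite block_mxEul; exact: s1.
- by under eq_fun do rewrite block_mxEur; exact: s2.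
- by under eq_fun do rewrite block_mxEdl; exact: s3.
- by under eq_fun do rewrite block_mxEdr; exact: s4.
Qed.

Lemma partial_block m1 m2 n1 n2 (X1 : V -> 'M[R]_(m1, n1))
    (X2 : V -> 'M[R]_(m1, n2)) (X3 : V -> 'M[R]_(m2, n1))
    (X4 : V -> 'M[R]_(m2, n2)) i u :
  smooth_on U X1 -> smooth_on U X2 -> smooth_on U X3 -> smooth_on U X4 ->
  U u ->
  partial i (fun w => block_mx (X1 w) (X2 w) (X3 w) (X4 w)) u =
  block_mx (partial i X1 u) (partial i X2 u) (partial i X3 u) (partial i X4 u).
Proof.
move=> s1 s2 s3 s4 Uu; apply/matrixP => a b.
rewrite (partial_mx i a b (smooth_on_exist (smooth_on_block s1 s2 s3 s4)) Uu).
case: (split_ordP a) => k ->; case: (split_ordP b) => l ->.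
- under eq_fun do rewrite block_mxEul.
  by rewrite block_mxEul (partial_mx i k l (smooth_on_exist s1) Uu).
- under eq_fun do rewrite block_mxEur.
  by rewrite block_mxEur (partial_mx i k l (smooth_on_exist s2) Uu).
- under eq_fun do rewrite block_mxEdl.
  by rewrite block_mxEdl (partial_mx i k l (smooth_on_exist s3) Uu).
- under eq_fun do rewrite block_mxEdr.
  by rewrite block_mxEdr (partial_mx i k l (smooth_on_exist s4) Uu).
Qed.

Lemma schwarz_mx m n (X : V -> 'M[R]_(m, n)) u i j : smooth_on U X -> U u ->
  partial i (partial j X) u = partial j (partial i X) u.
Proof.
move=> sX Uu; have /(smooth_on_mxP Uo) sX' := sX.
have E k l a b : partial k (partial l X) u a b =
    partial k (partial l (fun w => X w a b)) u.
  rewrite (partial_mx k a b (smooth_on_exist (smooth_on_partial l sX)) Uu).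
  apply: (partial_eq_on Uo k _ Uu) => w; rewrite inE => Uw.
  exact: partial_mx (smooth_on_exist sX) Uw.
have S a b := schwarz Uo i j (sX' a b) Uu.
apply/matrixP => a b.
exact: etrans (E i j a b) (etrans (S a b) (esym (E j i a b))).
Qed.

Lemma partial_row m n (X : V -> 'M[R]_(m, n)) a j u :
  smooth_on U X -> U u ->
  partial j (fun w => row a (X w)) u = row a (partial j X u).
Proof.
move=> sX Uu; have /(smooth_on_mxP Uo) sX' := sX.
have sr : smooth_on U (fun w => row a (X w)).
  apply/(smooth_on_mxP Uo) => a' b.
  by under eq_fun do rewrite mxE; exact: sX'.
apply/matrixP => a' b; rewrite (partial_mx j a' b (smooth_on_exist sr) Uu) mxE.
rewrite (partial_mx j a b (smooth_on_exist sX) Uu).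
by under eq_fun do rewrite mxE.
Qed.

(* The equation makes the [H]-products of any two solutions constant, because
   [B] is skew and [H] symmetric. *)
Lemma partial_skew_form n (B H : 'M[R]_n) (F F' : V -> 'M[R]_n) j u :
  smooth_on U F -> smooth_on U F' -> U u -> H^T = H -> B^T = - B ->
  partial j F u = B *m H *m F u -> partial j F' u = B *m H *m F' u ->
  partial j (fun w => (F w)^T *m H *m F' w) u = 0.
Proof.
move=> sF sF' Uu Hs Bs dF dF'.
have sFT := smooth_on_trmx sF.
have sFH := smooth_on_mulmx sFT (@smooth_on_cst _ _ U _ H).
rewrite (partial_mulmx j sFH sF' Uu) (partial_mulmx_cst H j sFT Uu).
rewrite (partial_trmx j sF Uu) dF dF' !trmx_mul Hs Bs.
by rewrite !(mulmxN, mulNmx) !mulmxA addNr.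
Qed.

End MatrixCalculus.

(** * Functions with vanishing partial derivatives *)

Section Constancy.
Variables (R : realType) (N : nat).
Notation V := 'rV[R]_N.

Lemma star_constant (U : set V) (z : V) m n (f : V -> 'M[R]_(m, n)) :
  open U -> U z ->
  (forall u (t : R), U u -> 0 <= t <= 1 -> U (t *: (u - z) + z)) ->
  smooth_on U f -> (forall u, U u -> forall i, partial i f u = 0) ->
  forall u, U u -> f u = f z.
Proof.
move=> Uo Uz Us sf df u Uu; apply/matrixP => a b.
have /(smooth_on_mxP Uo)/(_ a b) sfab := sf.
have [t t01] := mean_value_ray Uo (x := u - z) (z := z) sfab
  (fun t => Us u t Uu).
rewrite subrK big1 => [/eqP|i _]; first by rewrite subr_eq0 => /eqP.
have Ut := Us u t Uu t01.
have E := partial_mx i a b (smooth_on_exist sf) Ut.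
by rewrite df // mxE in E; rewrite -E mulr0.
Qed.

(** On small balls the star-shaped case applies, so [f] is locally constant and its level set
    through [z] is open and closed in [U]. *)
Lemma connected_constant (U : set V) (z : V) m n (f : V -> 'M[R]_(m, n)) :
  open U -> connected U -> U z -> smooth_on U f ->
  (forall u, U u -> forall i, partial i f u = 0) ->
  forall u, U u -> f u = f z.
Proof.
move=> Uo Uc Uz sf df.
have loc u : U u -> exists2 r : R, 0 < r &
    forall w, `|u - w| < r -> U w /\ f w = f u.
  move=> Uu; have /nbhs_normP[r r0 rU] : \forall w \near u, U w.
    exact: open_nbhs_nbhs.
  exists r => // w uw; split; first exact: rU.
  apply: (@star_constant (ball u r) u) => //.
  - exact: ball_open.
  - exact: ballxx.
  - move=> v t; rewrite -!ball_normE /= opprD addrCA subrr addr0 normrN normrZ.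
    rewrite distrC => h /andP[t0 t1]; rewrite ger0_norm //.
    by apply: le_lt_trans h; rewrite ler_piMl.
  - by apply: smooth_onS sf => v; rewrite -ball_normE; exact: rU.
  - by move=> v; rewrite -ball_normE => /rU Uv i; exact: df.
  - by rewrite -ball_normE.
(* Used for the value [f z] and for its complement, which gives openness and closedness
   respectively. *)
have opn (P : set 'M[R]_(m, n)) : open [set u | U u /\ P (f u)].
  rewrite openE => u [Uu Pu]; have [r r0 rP] := loc u Uu.
  suff HH : \forall w \near u, U w /\ P (f w) by exact: HH.
  by apply/nbhs_normP; exists r => // w /rP[Uw Ew]; split; rewrite ?Ew.
suff E : [set u | U u /\ f u = f z] = U by move=> u; rewrite -{1}E => -[].
apply: Uc.
- by exists z.
- exists [set u | U u /\ f u = f z]; first exact: (opn [set x | x = f z]).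
  by apply/seteqP; split=> u [] //= Uu [].
- exists (~` [set u | U u /\ f u <> f z]).
    exact: open_closedC (opn [set x | x <> f z]).
  apply/seteqP; split=> u [Uu] /=; first by move=> E; split=> // -[].
  by move=> nE; split=> //; apply: contrapT => E; apply: nE.
Qed.

End Constancy.

Section Dot.
Variables (R : realType) (N D : nat) (G : 'M[R]_D).
Notation V := 'rV[R]_N.

Lemma dot_row m n (X : 'M[R]_(m, D)) (Y : 'M[R]_(n, D)) a b :
  dot G (row a X) (row b Y) = (X *m G *m Y^T) a b.
Proof.
rewrite /dot -row_mul tr_row !mxE; apply: eq_bigr => c _.
by rewrite !mxE.
Qed.

Lemma dot_rowr n x (Y : 'M[R]_(n, D)) b :
  dot G x (row b Y) = (x *m G *m Y^T) 0 b.
Proof.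
rewrite -dot_row; congr (dot G _ _).
by apply/rowP => j; rewrite [RHS]mxE.
Qed.

Lemma dotC x y : G^T = G -> dot G x y = dot G y x.
Proof.
move=> Gs; rewrite /dot; have -> : x *m G *m y^T = (y *m G *m x^T)^T.
  by rewrite !trmx_mul trmxK Gs mulmxA.
by rewrite mxE.
Qed.

Lemma partial_dot (U : set V) (x y : V -> 'rV[R]_D) i u :
  open U -> smooth_on U x -> smooth_on U y -> U u ->
  partial i (fun w => dot G (x w) (y w)) u =
  dot G (partial i x u) (y u) + dot G (x u) (partial i y u).
Proof.
move=> Uo sx sy Uu; rewrite /dot.
have sxG := smooth_on_mulmx Uo sx (@smooth_on_cst _ _ U _ G).
have syT := smooth_on_trmx Uo sy.
rewrite -(partial_mx i 0 0 (smooth_on_exist (smooth_on_mulmx Uo sxG syT)) Uu).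
rewrite (partial_mulmx Uo i sxG syT Uu) (partial_mulmx_cst Uo G i sx Uu).
by rewrite (partial_trmx Uo i sy Uu) mxE.
Qed.

End Dot.

(** * Gauss, Codazzi and Ricci equations for a potential *)

Lemma mulmx_form (R : comNzRingType) m n a b (X : 'M[R]_(a, m))
    (M : 'M[R]_(m, n)) (Y : 'M[R]_(b, n)) i j :
  (X *m M *m Y^T) i j = \sum_x \sum_y X i x * M x y * Y j y.
Proof.
rewrite mxE exchange_big; apply: eq_bigr => y _ /=.
by rewrite !mxE mulr_suml.
Qed.

Section StructureMatrices.
Variables (R : comNzRingType) (N k p : nat) (hN : (0 < N)%N) (hk : (0 < k)%N).
Notation L := (k * N + p)%N.
Variables (eta : 'M[R]_N) (c : 'M[R]_k) (mu : 'M[R]_L).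
Hypothesis hblock : forall (s t : 'I_k) (m n : 'I_N),
  mu (block_index p s m) (block_index p t n) = c s t * eta m n.
Variable T : 'I_N -> 'I_N -> 'I_N -> R.

(** The matrix of [T] with last index [j], repeated [k] times side by side and followed by [p] zero
    columns. [T] stands for the third derivatives of the potential at one point, so that what
    follows is pure algebra. *)
Definition structure_mx (j : 'I_N) : 'M[R]_(N, L) :=
  \matrix_(i, al) if (al < k * N)%N then T (block_pos hN al) i j else 0.

Lemma structure_mx_ge (j i : 'I_N) (al : 'I_L) : (k * N <= al)%N ->
  structure_mx j i al = 0.
Proof. by rewrite mxE leqNgt => /negbTE ->. Qed.

Lemma structure_mx_block (j i m : 'I_N) (s : 'I_k) :
  structure_mx j i (block_index p s m) = T m i j.
Proof. by rewrite mxE block_index_lt block_pos_index. Qed.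

Hypothesis T12 : forall a b d, T a b d = T b a d.
Hypothesis T23 : forall a b d, T a b d = T a d b.
Hypothesis assoc_T : forall i j m n,
  \sum_a \sum_b T i j a * eta a b * T b m n
  = \sum_a \sum_b T i m a * eta a b * T b j n.

(** Associativity with its indices moved, by the total symmetry of [T], to where the Gauss and Ricci
    equations produce them. *)
Lemma assoc_swap l m i j :
  \sum_a \sum_b T a l i * eta a b * T b m j
  = \sum_a \sum_b T a l j * eta a b * T b m i.
Proof.
have E x y : \sum_a \sum_b T a l x * eta a b * T b m y
    = \sum_a \sum_b T l x a * eta a b * T b y m.
  apply: eq_bigr => a _; apply: eq_bigr => b _.
  by rewrite (T12 a) (T23 l) (T23 b m).
by rewrite !E assoc_T.
Qed.

(** The zero columns confine the sum to the blocks, where [mu] is the tensor product of [c] and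
    [eta]. Each pair of blocks thus contributes [c s t] times one and the same associativity sum. *)
Lemma gauss_sym i j :
  structure_mx i *m mu *m (structure_mx j)^T =
  structure_mx j *m mu *m (structure_mx i)^T.
Proof.
apply/matrixP => l m; rewrite !mulmx_form.
have E x y :
    \sum_al \sum_be structure_mx x l al * mu al be * structure_mx y m be
    = \sum_s \sum_t c s t * \sum_a \sum_b T a l x * eta a b * T b m y.
  rewrite (sum_block_index hN hk); last first.
    by move=> al lt; rewrite big1 // => be _; rewrite structure_mx_ge ?mul0r.
  apply: eq_bigr => s _.
  transitivity (\sum_(a < N) \sum_(t < k) \sum_(b < N) c s t *
      (T a l x * eta a b * T b m y)).
    apply: eq_bigr => a _; rewrite (sum_block_index hN hk); last first.
      by move=> be lt; rewrite [structure_mx y _ _]structure_mx_ge ?mulr0.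
    apply: eq_bigr => t _; apply: eq_bigr => b _.
    by rewrite !structure_mx_block hblock mulrCA !mulrA.
  rewrite exchange_big /=; apply: eq_bigr => t _.
  by rewrite mulr_sumr; apply: eq_bigr => a _; rewrite mulr_sumr.
rewrite !E; apply: eq_bigr => s _; apply: eq_bigr => t _.
by rewrite assoc_swap.
Qed.

(** The entry for two normals depends only on their positions inside the blocks, and it is again an
    associativity sum. *)
Lemma ricci_sym i j :
  (structure_mx i)^T *m eta *m structure_mx j =
  (structure_mx j)^T *m eta *m structure_mx i.
Proof.
apply/matrixP => al be.
have E x y : ((structure_mx x)^T *m eta *m structure_mx y) al be =
    if (al < k * N)%N && (be < k * N)%N then \sum_a \sum_b
      T a (block_pos hN al) x * eta a b * T b (block_pos hN be) y else 0.
  rewrite -[structure_mx y]trmxK mulmx_form; case: ifP => [/andP[la lb]|H].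
    apply: eq_bigr => a _; apply: eq_bigr => b _.
    by rewrite !mxE la lb (T12 _ a) (T12 _ b).
  rewrite big1 // => a _; rewrite big1 // => b _; rewrite !mxE; move: H.
  by case: (al < _)%N => /=; [move=> ->; rewrite mulr0|rewrite !mul0r].
by rewrite !E; case: ifP => // _; exact: assoc_swap.
Qed.

End StructureMatrices.

(** The product of two off-diagonal blocks is block diagonal, so commutation splits into a
    tangential identity (Gauss) and a normal one (Ricci). *)
Lemma block_skew_comm (R : comNzRingType) m n (e : 'M[R]_m) (f : 'M[R]_n)
    (X Y : 'M[R]_(m, n)) :
  X *m f *m Y^T = Y *m f *m X^T -> X^T *m e *m Y = Y^T *m e *m X ->
  (block_mx 0 X (- X^T) 0 *m block_mx e 0 0 f) *m
    (block_mx 0 Y (- Y^T) 0 *m block_mx e 0 0 f) =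
  (block_mx 0 Y (- Y^T) 0 *m block_mx e 0 0 f) *m
    (block_mx 0 X (- X^T) 0 *m block_mx e 0 0 f).
Proof.
move=> g r; rewrite !mulmxA; congr (_ *m _); rewrite !mulmx_block.
by rewrite !(mulmx0, mul0mx, addr0, add0r, mulNmx, mulmxN) g r.
Qed.

Section Potential.
Variables (R : realType) (N k p : nat) (hN : (0 < N)%N).
Notation L := (k * N + p)%N.
Notation V := 'rV[R]_N.
Variables (eta : 'M[R]_N) (c : 'M[R]_k) (mu : 'M[R]_L).
Variables (Phi : V -> R) (W : set V).
Hypotheses (Wo : open W) (sPhi : smooth_on W Phi).

(** The case distinction stands outside the function, so that either branch can be differentiated as
    a whole. *)
Definition second_coef (al : 'I_L) (i j : 'I_N) : V -> R :=
  if (al < k * N)%N then partials [:: block_pos hN al; i; j] Phi else fun=> 0.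

Lemma second_coef_lt (al : 'I_L) i j : (al < k * N)%N ->
  second_coef al i j = partials [:: block_pos hN al; i; j] Phi.
Proof. by rewrite /second_coef => ->. Qed.

Lemma second_coef_ge (al : 'I_L) i j : (k * N <= al)%N ->
  second_coef al i j = fun=> 0.
Proof. by rewrite /second_coef leqNgt => /negbTE ->. Qed.

Definition second_coefs (j : 'I_N) (u : V) : 'M[R]_(N, L) :=
  structure_mx k p hN (fun a b d => partials [:: a; b; d] Phi u) j.

Lemma second_coefsE j u i al : second_coefs j u i al = second_coef al i j u.
Proof.
rewrite mxE; case: (ltnP al (k * N)) => lt.
  by rewrite (second_coef_lt i j lt).
by rewrite (second_coef_ge i j lt).
Qed.

(* The Gauss-Weingarten equations read
   [d_j F = frame_skew j *m frame_form *m F], where the rows of [F] are the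
   tangent vectors followed by the normals. *)
Definition frame_skew (j : 'I_N) (u : V) : 'M[R]_(N + L) :=
  block_mx 0 (second_coefs j u) (- (second_coefs j u)^T) 0.

Definition frame_form : 'M[R]_(N + L) := block_mx eta 0 0 mu.

Definition frame_gram : 'M[R]_(N + L) := block_mx (invmx eta) 0 0 (invmx mu).

Lemma third_swap12 u a b d : W u ->
  partials [:: a; b; d] Phi u = partials [:: b; a; d] Phi u.
Proof. by move=> Wu; exact: (schwarz Wo a b (smooth_on_partial d sPhi) Wu). Qed.

Lemma third_swap23 u a b d : W u ->
  partials [:: a; b; d] Phi u = partials [:: a; d; b] Phi u.
Proof.
move=> Wu; apply: (partial_eq_on Wo a _ Wu) => w; rewrite inE => Ww.
exact: (schwarz Wo b d sPhi Ww).
Qed.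

Lemma smooth_partials (s : seq 'I_N) : smooth_on W (partials s Phi).
Proof. by elim: s => [|i s IH]; [exact: sPhi|exact: smooth_on_partial IH]. Qed.

Lemma smooth_second_coef al i j : smooth_on W (second_coef al i j).
Proof.
case: (ltnP al (k * N)) => lt.
  by rewrite (second_coef_lt i j lt); exact: smooth_partials.
by rewrite (second_coef_ge i j lt); exact: (@smooth_on_cst _ _ W _ 0).
Qed.

Lemma second_coefC al i j u : W u ->
  second_coef al i j u = second_coef al j i u.
Proof.
move=> Wu; case: (ltnP al (k * N)) => lt.
  rewrite (second_coef_lt i j lt) (second_coef_lt j i lt).
  exact: third_swap23.
by rewrite (second_coef_ge i j lt) (second_coef_ge j i lt).
Qed.

(** The Codazzi equations: in the blocks both sides are the same fourth derivative of [Phi]. *)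
Lemma partial_second_coef al l i j u : W u ->
  partial i (second_coef al l j) u = partial j (second_coef al l i) u.
Proof.
move=> Wu; case: (ltnP al (k * N)) => lt; last first.
  by rewrite (second_coef_ge l i lt) (second_coef_ge l j lt) !partial_cst.
rewrite (second_coef_lt l i lt) (second_coef_lt l j lt).
have E x : {in W, partials [:: block_pos hN al; l; x] Phi =1
    partial x (partials [:: block_pos hN al; l] Phi)}.
  move=> w; rewrite inE => Ww.
  exact: etrans (third_swap23 _ _ _ Ww) (third_swap12 _ _ _ Ww).
have E1 := partial_eq_on Wo i (E j) Wu.
have E2 := partial_eq_on Wo j (E i) Wu.
have S := schwarz Wo i j (smooth_partials [:: block_pos hN al; l]) Wu.
by refine (eq_trans E1 _); refine (eq_trans S _); symmetry; exact E2.
Qed.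

Lemma smooth_second_coefs j : smooth_on W (second_coefs j).
Proof.
apply/(smooth_on_mxP Wo) => a b.
rewrite (_ : (fun _ => _) = second_coef b a j); first exact: smooth_second_coef.
by apply/funext => w; exact: second_coefsE.
Qed.

Lemma smooth_frame_skew j : smooth_on W (frame_skew j).
Proof.
have s := smooth_second_coefs j.
have s0 m n := @smooth_on_cst R N W 'M[R]_(m, n) 0.
have sN := smooth_on_oppmx Wo (smooth_on_trmx Wo s).
have H := smooth_on_block Wo (s0 N N) s sN (s0 L L); exact H.
Qed.

Lemma frame_skew_tr j u : (frame_skew j u)^T = - frame_skew j u.
Proof.
rewrite /frame_skew tr_block_mx opp_block_mx !trmx0 !oppr0.
by rewrite linearN /= trmxK opprK.
Qed.

Lemma partial_frame_skew i j u : W u ->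
  partial i (frame_skew j) u = partial j (frame_skew i) u.
Proof.
move=> Wu; have s x := smooth_second_coefs x.
have sT x := smooth_on_trmx Wo (s x).
have s0 m n := @smooth_on_cst R N W 'M[R]_(m, n) 0.
have E x y : partial x (frame_skew y) u =
    block_mx 0 (partial x (second_coefs y) u)
      (- (partial x (second_coefs y) u)^T) 0.
  rewrite /frame_skew.
  have sN := smooth_on_oppmx Wo (sT y).
  rewrite (partial_block Wo x (s0 _ _) (s y) sN (s0 _ _) Wu) !partial_cst.
  by rewrite (partial_oppmx x (sT y) Wu) (partial_trmx Wo x (s y) Wu).
rewrite (E i j) (E j i).
have -> // : partial i (second_coefs j) u = partial j (second_coefs i) u.
apply/matrixP => a b.
have P x y : partial x (second_coefs y) u a b = partial x (second_coef b a y) u.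
  rewrite (partial_mx x a b (smooth_on_exist (s y)) Wu).
  by congr (partial x _ u); apply/funext => w; exact: second_coefsE.
refine (eq_trans (P i j) _).
refine (eq_trans (partial_second_coef b a i j Wu) _).
by symmetry; exact (P j i).
Qed.

Lemma form_mul_gram : eta \in unitmx -> mu \in unitmx ->
  frame_form *m frame_gram = 1%:M.
Proof.
move=> eu mu_u; rewrite /frame_form /frame_gram mulmx_block.
by rewrite !(mulmx0, mul0mx, addr0, add0r) !mulmxV // -scalar_mx_block.
Qed.

Hypothesis hk : (0 < k)%N.
Hypothesis hblock : forall (s t : 'I_k) (m n : 'I_N),
  mu (block_index p s m) (block_index p t n) = c s t * eta m n.
Hypothesis hassoc : associativity_on eta W Phi.

Lemma frame_skew_comm i j u : W u ->
  (frame_skew i u *m frame_form) *m (frame_skew j u *m frame_form) =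
  (frame_skew j u *m frame_form) *m (frame_skew i u *m frame_form).
Proof.
move=> Wu.
have T12 a b d := third_swap12 a b d Wu.
have T23 a b d := third_swap23 a b d Wu.
apply: block_skew_comm.
  exact (gauss_sym hN hk hblock T12 T23 (hassoc Wu) i j).
exact (ricci_sym k p hN T12 T23 (hassoc Wu) i j).
Qed.

End Potential.

(** * Adapted frames *)

(** The Christoffel symbols vanish on an open set, hence so do their derivatives. *)
Lemma flat_constant_metric (R : realType) (N : nat) (U : set 'rV[R]_N)
    (g : 'rV[R]_N -> 'M[R]_N) (g0 : 'M[R]_N) :
  open U -> (forall u, U u -> g u = g0) -> flat_metric_on g U.
Proof.
move=> Uo gU.
have dg i a b u : U u -> partial i (fun v => g v a b) u = 0.
  move=> Uu; rewrite -(partial_cst (g0 a b) i u).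
  apply: (partial_eq_on Uo i _ Uu) => v; rewrite inE => Uv.
  by rewrite gU.
have ch l i j u : U u -> christoffel g l i j u = 0.
  move=> Uu; rewrite /christoffel big1 ?mulr0 // => a _.
  by rewrite !dg // addr0 subr0 mulr0.
have dch m l i j u : U u -> partial m (christoffel g l i j) u = 0.
  move=> Uu; rewrite -(partial_cst (0 : R) m u).
  by apply: (partial_eq_on Uo m _ Uu) => v; rewrite inE => Uv; exact: ch.
move=> u Uu l m i j; rewrite /riemann !dch // subr0 add0r big1 // => a _.
by rewrite !ch // !mulr0 subr0.
Qed.

(** * Frames satisfying the same skew equation *)

Section Rigidity.
Variables (R : realType) (N n : nat) (U : set 'rV[R]_N).
Notation V := 'rV[R]_N.
Variables (G H K : 'M[R]_n) (B : 'I_N -> V -> 'M[R]_n).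
Hypothesis Uo : open U.
Hypothesis Hs : H^T = H.
Hypothesis HK : H *m K = 1%:M.
Hypothesis Bs : forall j u, (B j u)^T = - B j u.

(** Rewrites the Gram condition in terms of [F^T *m H *m F], the quantity that the equation keeps
    constant, and at the same time exhibits the inverse of [F]. *)
Lemma gram_inverse (F : 'M[R]_n) :
  F *m G *m F^T = K -> (G *m F^T *m H) *m F = 1%:M.
Proof.
move=> FG; apply: mulmx1C.
by rewrite !mulmxA FG; exact: mulmx1C.
Qed.

Lemma gram_of_inverse (F : 'M[R]_n) :
  (G *m F^T *m H) *m F = 1%:M -> F *m G *m F^T = K.
Proof.
move=> /mulmx1C; rewrite !mulmxA => FG.
by rewrite -[LHS]mulmx1 -HK mulmxA FG mul1mx.
Qed.

Variables (F F' : V -> 'M[R]_n).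
Hypothesis sF : smooth_on U F.
Hypothesis dF : forall u, U u -> forall j, partial j F u = B j u *m H *m F u.

Lemma frame_rigidity (z : V) : connected U -> U z ->
  smooth_on U F' ->
  (forall u, U u -> forall j, partial j F' u = B j u *m H *m F' u) ->
  (forall u, U u -> F u *m G *m (F u)^T = K) ->
  (forall u, U u -> F' u *m G *m (F' u)^T = K) ->
  exists2 A : 'M[R]_n, A *m G *m A^T = G & forall u, U u -> F' u = F u *m A.
Proof.
move=> Uc Uz sF' dF' FG FG'.
pose f w := (F w)^T *m H *m F' w.
have sf : smooth_on U f.
  have sFT := smooth_on_trmx Uo sF.
  have sFH := smooth_on_mulmx Uo sFT (@smooth_on_cst _ _ U _ H).
  exact (smooth_on_mulmx Uo sFH sF').
have df u : U u -> forall j, partial j f u = 0.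
  move=> Uu j.
  exact (partial_skew_form Uo sF sF' Uu Hs (Bs j u) (dF Uu j) (dF' u Uu j)).
have fE := connected_constant Uo Uc Uz sf df.
(* Since [f] is constant, [F u *m A] is [F u *m G *m (F u)^T *m H *m F' u], that is
   [K *m H *m F' u]. *)
pose A := G *m f z.
have FA u : U u -> F' u = F u *m A.
  move=> Uu; rewrite /A -(fE u Uu) /f !mulmxA FG //.
  by rewrite (mulmx1C HK) mul1mx.
exists A; last exact: FA.
clearbody A.
have Gi := gram_inverse (FG z Uz).
set X := G *m (F z)^T *m H in Gi.
have Gi' := mulmx1C Gi.
(* Both frames have Gram matrix [K] at [z]; cancelling the invertible [F z] on either side shows
   that [A] preserves [G]. *)
have E : F z *m (A *m G *m A^T) *m (F z)^T = F z *m G *m (F z)^T.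
  by rewrite FG // -(FG' z Uz) FA // trmx_mul !mulmxA.
have XT : (F z)^T *m X^T = 1%:M by rewrite -trmx_mul Gi trmx1.
have := congr1 (fun M => X *m M *m X^T) E; rewrite /= !mulmxA Gi.
by rewrite !mul1mx -!mulmxA XT !mulmx1.
Qed.

Lemma frame_gram_constant (z : V) : U z ->
  (forall u (t : R), U u -> 0 <= t <= 1 -> U (t *: (u - z) + z)) ->
  F z *m G *m (F z)^T = K ->
  forall u, U u -> F u *m G *m (F u)^T = K.
Proof.
move=> Uz Us Fz u Uu; apply: gram_of_inverse.
pose f w := (F w)^T *m H *m F w.
have sf : smooth_on U f.
  have sFT := smooth_on_trmx Uo sF.
  have sFH := smooth_on_mulmx Uo sFT (@smooth_on_cst _ _ U _ H).
  exact (smooth_on_mulmx Uo sFH sF).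
have df v : U v -> forall j, partial j f v = 0.
  move=> Uv j.
  exact (partial_skew_form Uo sF sF Uv Hs (Bs j v) (dF Uv j) (dF Uv j)).
have fE := star_constant Uo Uz Us sf df Uu.
have := gram_inverse Fz; rewrite -!mulmxA => <-.
by congr (G *m _); rewrite !mulmxA; exact fE.
Qed.

End Rigidity.

Lemma gram_cross (R : comNzRingType) m n D (F : 'M[R]_(m + n, D)) (G : 'M[R]_D)
    (E : 'M[R]_m) (M : 'M[R]_n) :
  F *m G *m F^T = block_mx E 0 0 M -> dsubmx F *m G *m (usubmx F)^T = 0.
Proof.
rewrite -{1 2}[F]vsubmxK tr_col_mx mul_col_mx mul_col_row.
by move=> /eq_block_mx[_ _ -> _].
Qed.

Lemma identity_rows (R : nzRingType) m n :
  1%:M = col_mx (row_mx 1%:M 0) (row_mx 0 1%:M) :> 'M[R]_(m + n).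
Proof. by rewrite -block_mxEv -scalar_mx_block. Qed.

Section Frames.
Variables (R : realType) (N D L : nat) (G : 'M[R]_D) (U : set 'rV[R]_N).
Notation V := 'rV[R]_N.
Hypothesis Uo : open U.
Hypothesis Gs : G^T = G.

Definition frame (r : V -> 'rV[R]_D) (n : 'I_L -> V -> 'rV[R]_D) (u : V)
    : 'M[R]_(N + L, D) :=
  col_mx (\matrix_(i < N) partial i r u) (\matrix_(al < L) n al u).

(** * From a submanifold to its frame *)

Section OfSubmanifold.
Variables (r : V -> 'rV[R]_D) (n : 'I_L -> V -> 'rV[R]_D).

Lemma frame_rowl i u : row (lshift L i) (frame r n u) = partial i r u.
Proof. by rewrite -[LHS]row_usubmx col_mxKu rowK. Qed.

Lemma frame_rowr al u : row (rshift N al) (frame r n u) = n al u.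
Proof. by rewrite -[LHS]row_dsubmx col_mxKd rowK. Qed.

Lemma smooth_from_rows m (X : V -> 'M[R]_(m, D)) :
  (forall a, smooth_on U (fun w => row a (X w))) -> smooth_on U X.
Proof.
move=> sX; apply/(smooth_on_mxP Uo) => a b.
have /(smooth_on_mxP Uo)/(_ 0 b) := sX a.
by under eq_fun do rewrite mxE.
Qed.

Hypothesis sr : smooth_on U r.
Hypothesis sn : forall al, smooth_on U (n al).

Lemma smooth_frame : smooth_on U (frame r n).
Proof.
apply: smooth_from_rows => a; case: (split_ordP a) => i ->.
  rewrite (_ : (fun _ => _) = partial i r); first exact: smooth_on_partial sr.
  by apply/funext => w; exact: frame_rowl.
rewrite (_ : (fun _ => _) = n i); first exact: sn.
by apply/funext => w; exact: frame_rowr.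
Qed.

Lemma partial_frame_rowl i j u : U u ->
  row (lshift L i) (partial j (frame r n) u) = partial j (partial i r) u.
Proof.
move=> Uu; have E := partial_row Uo (lshift L i) j smooth_frame Uu.
refine (eq_trans (esym E) _).
congr (partial j _ u); apply/funext => w; exact: frame_rowl.
Qed.

Lemma partial_frame_rowr al j u : U u ->
  row (rshift N al) (partial j (frame r n) u) = partial j (n al) u.
Proof.
move=> Uu; have E := partial_row Uo (rshift N al) j smooth_frame Uu.
refine (eq_trans (esym E) _).
congr (partial j _ u); apply/funext => w; exact: frame_rowr.
Qed.

Lemma dot_constant (x y : V -> 'rV[R]_D) (d : R) i u :
  smooth_on U x -> smooth_on U y -> U u ->
  (forall w, U w -> dot G (x w) (y w) = d) ->
  dot G (partial i x u) (y u) + dot G (x u) (partial i y u) = 0.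
Proof.
move=> sx sy Uu H; refine (eq_trans (esym (partial_dot G i Uo sx sy Uu)) _).
refine (eq_trans _ (partial_cst d i u)).
by apply: (partial_eq_on Uo i _ Uu) => w; rewrite inE; exact: H.
Qed.

Variable (E0 : 'M[R]_N).
Hypothesis ffE : forall u, U u -> first_form G r u = E0.

Lemma first_formE u i j : U u ->
  dot G (partial i r u) (partial j r u) = E0 i j.
Proof. by move=> Uu; rewrite -(ffE Uu) mxE. Qed.

(* The Christoffel symbols of the first kind vanish since the metric is
   constant. *)
Lemma second_derivative_normal u l i m : U u ->
  dot G (partial l (partial i r) u) (partial m r u) = 0.
Proof.
move=> Uu.
(* Symmetric in the first two indices and skew in the last two: alternating the two swaps three
   times restores the order but changes the sign. *)
pose T a b d := dot G (partial a (partial b r) u) (partial d r u).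
have T12 a b d : T a b d = T b a d.
  exact (f_equal (fun x => dot G x (partial d r u)) (schwarz_mx Uo a b sr Uu)).
have T23 a b d : T a b d = - T a d b.
  have := dot_constant a (smooth_on_partial b sr) (smooth_on_partial d sr) Uu
    (fun w Uw => first_formE b d Uw).
  rewrite [X in _ + X](dotC _ _ Gs) => /eqP.
  by rewrite addr_eq0 => /eqP.
suff : T l i m = - T l i m.
  by move=> /eqP; rewrite -addr_eq0 -mulr2n mulrn_eq0 /= => /eqP.
by rewrite {1}T23 T12 T23 opprK T12 T23 T12.
Qed.

Variable (M0 : 'M[R]_L).
Hypothesis ngE : forall u, U u -> normal_gram G n u = M0.
Hypothesis normal : forall u, U u -> forall al i,
  dot G (n al u) (partial i r u) = 0.

Lemma frame_gramE u : U u ->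
  frame r n u *m G *m (frame r n u)^T = block_mx E0 0 0 M0.
Proof.
move=> Uu; apply/matrixP => a b; refine (eq_trans (esym (dot_row G _ _ a b)) _).
case: (split_ordP a) => i ->; case: (split_ordP b) => j ->.
- by rewrite !frame_rowl block_mxEul first_formE.
- by rewrite frame_rowl frame_rowr block_mxEur dotC // normal // mxE.
- by rewrite frame_rowl frame_rowr block_mxEdl normal // mxE.
- by rewrite !frame_rowr block_mxEdr -(ngE Uu) mxE.
Qed.

Variable (w : 'I_N -> V -> 'M[R]_(N, L)).
Hypothesis sfE : forall u, U u -> forall al i j,
  second_form G r n al u j i = w j u i al.
Hypothesis tor : forall u, U u -> forall i al be, torsion G n i al be u = 0.

(** The four blocks have four reasons: constancy of the metric, the definition of the second forms,
    the derivative of the orthogonality relation, and the vanishing torsion. *)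
Lemma gauss_weingarten u j : U u ->
  partial j (frame r n) u *m G *m (frame r n u)^T =
  block_mx 0 (w j u) (- (w j u)^T) 0.
Proof.
move=> Uu.
have sfE' i al : dot G (partial j (partial i r) u) (n al u) = w j u i al.
  by rewrite -(sfE Uu) mxE.
apply/matrixP => a b; refine (eq_trans (esym (dot_row G _ _ a b)) _).
case: (split_ordP a) => i ->; case: (split_ordP b) => l ->.
- refine (eq_trans (f_equal2 (dot G) (partial_frame_rowl i j Uu)
    (frame_rowl l u)) _).
  by rewrite block_mxEul mxE; exact: second_derivative_normal.
- refine (eq_trans (f_equal2 (dot G) (partial_frame_rowl i j Uu)
    (frame_rowr l u)) _).
  by rewrite block_mxEur; exact: sfE'.
- refine (eq_trans (f_equal2 (dot G) (partial_frame_rowr i j Uu)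
    (frame_rowl l u)) _).
  rewrite block_mxEdl mxE [in RHS]mxE -sfE'.
  have := dot_constant j (sn i) (smooth_on_partial l sr) Uu
    (fun v Uv => normal Uv i l).
  by move/eqP; rewrite addr_eq0 => /eqP ->; rewrite dotC.
- refine (eq_trans (f_equal2 (dot G) (partial_frame_rowr i j Uu)
    (frame_rowr l u)) _).
  by rewrite block_mxEdr mxE; exact: (tor Uu j i l).
Qed.

End OfSubmanifold.

(** * From a frame back to a submanifold *)

Section ToSubmanifold.
Variables (r : V -> 'rV[R]_D) (F : V -> 'M[R]_(N + L, D)).
Variables (E0 : 'M[R]_N) (M0 : 'M[R]_L) (w : 'I_N -> V -> 'M[R]_(N, L)).
Hypothesis E0u : E0 \in unitmx.
Hypothesis sr : smooth_on U r.
Hypothesis sF : smooth_on U F.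
Hypothesis dr : forall u, U u -> forall i,
  partial i r u = row (lshift L i) (F u).
Hypothesis FG : forall u, U u -> F u *m G *m (F u)^T = block_mx E0 0 0 M0.
Hypothesis dF : forall u, U u -> forall j,
  partial j F u *m G *m (F u)^T = block_mx 0 (w j u) (- (w j u)^T) 0.
Hypothesis Finv : forall u, U u -> exists X, F u *m X = 1%:M /\ X *m F u = 1%:M.

Definition normals (al : 'I_L) (u : V) : 'rV[R]_D := row (rshift N al) (F u).

Lemma smooth_normals al : smooth_on U (normals al).
Proof.
have /(smooth_on_mxP Uo) sF' := sF; apply/(smooth_on_mxP Uo) => a b.
by under eq_fun do rewrite mxE; exact: sF'.
Qed.

Lemma frame_first_form u : U u -> first_form G r u = E0.
Proof.
move=> Uu; apply/matrixP => i j; rewrite mxE !dr // dot_row FG //.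
exact: block_mxEul.
Qed.

Lemma frame_normal_gram u : U u -> normal_gram G normals u = M0.
Proof.
move=> Uu; apply/matrixP => i j; rewrite mxE dot_row FG //.
exact: block_mxEdr.
Qed.

Lemma partial_partial_frame u i j : U u ->
  partial i (partial j r) u = row (lshift L j) (partial i F u).
Proof.
move=> Uu; refine (eq_trans _ (partial_row Uo (lshift L j) i sF Uu)).
by apply: (partial_eq_on Uo i _ Uu) => v; rewrite inE => Uv; exact: dr.
Qed.

Lemma frame_second_form u al i j : U u ->
  second_form G r normals al u i j = w i u j al.
Proof.
move=> Uu; rewrite mxE.
have E := partial_partial_frame i j Uu.
refine (eq_trans (f_equal (fun x => dot G x _) E) _).
by rewrite dot_row dF //; exact: block_mxEur.
Qed.

Lemma frame_torsion u i al be : U u -> torsion G normals i al be u = 0.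
Proof.
move=> Uu; rewrite /torsion.
refine (eq_trans (f_equal (fun x => dot G x _) (partial_row Uo _ i sF Uu)) _).
by rewrite dot_row dF // block_mxEdr mxE.
Qed.

(** A vector [v] has coordinates [v *m X] in the frame. If it is orthogonal to the tangent rows, the
    tangential coordinates are killed by the invertible [E0], so [v] is a combination of the
    normals. *)
Lemma normals_basis : normal_basis_on G U r normals.
Proof.
split=> [|u Uu B]; first exact: smooth_normals.
have [X [FX XF]] := Finv Uu.
have BE : B = dsubmx (F u).
  by apply/row_matrixP => al; rewrite rowK row_dsubmx.
have cross : B *m G *m (usubmx (F u))^T = 0.
  by rewrite BE; exact: gram_cross (FG Uu).
split.
  (* The columns of the inverse [X] that belong to the normals. *)
  apply/row_freeP; exists (X *m col_mx 0 1%:M).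
  rewrite mulmxA BE; have -> : dsubmx (F u) *m X = row_mx 0 1%:M.
    have := congr1 dsubmx FX.
    rewrite -{1}[F u]vsubmxK mul_col_mx col_mxKd => ->.
    by rewrite identity_rows col_mxKd.
  by rewrite mul_row_col mul0mx add0r mulmx1.
move=> v; split=> [/submxP[q ->] i|nv].
  rewrite dr // -row_usubmx dot_rowr.
  by rewrite -!mulmxA (mulmxA B) cross mulmx0 mxE.
have vU : v *m G *m (usubmx (F u))^T = 0.
  apply/rowP => i; have := nv i; rewrite dr // -row_usubmx dot_rowr.
  by move=> ->; rewrite mxE.
have GF : G *m (F u)^T = X *m block_mx E0 0 0 M0.
  by rewrite -(FG Uu) !mulmxA XF mul1mx.
have vq : v *m X *m block_mx E0 0 0 M0 = row_mx 0 (v *m G *m B^T).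
  rewrite -mulmxA -GF mulmxA -{1}[F u]vsubmxK tr_col_mx mul_mx_row vU BE.
  by [].
have vX0 : lsubmx (v *m X) = 0.
  have := congr1 lsubmx vq; rewrite row_mxKl -{1}[v *m X]hsubmxK mul_row_block.
  rewrite row_mxKl mulmx0 addr0 => H.
  by rewrite -[LHS](mulmxK E0u) H mul0mx.
apply/submxP; exists (rsubmx (v *m X)).
rewrite -[LHS]mulmx1 -XF mulmxA -{1}[v *m X]hsubmxK vX0 -{1}[F u]vsubmxK.
by rewrite mul_row_col mul0mx add0r BE.
Qed.

Lemma frame_immersion : immersion_on U r.
Proof.
split=> // u Uu; have [X [FX XF]] := Finv Uu.
have -> : \matrix_i partial i r u = usubmx (F u).
  by apply/row_matrixP => i; rewrite rowK row_usubmx dr.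
apply/row_freeP; exists (X *m col_mx 1%:M 0).
rewrite mulmxA; have -> : usubmx (F u) *m X = row_mx 1%:M 0.
  have := congr1 usubmx FX; rewrite -{1}[F u]vsubmxK mul_col_mx col_mxKu => ->.
  by rewrite identity_rows col_mxKu.
by rewrite mul_row_col mulmx0 addr0 mulmx1.
Qed.

Lemma submanifold_of_frame : flat_torsionless_submanifold G U r normals.
Proof.
split.
- exact: frame_immersion.
- by move=> u Uu; rewrite frame_first_form.
- exact: flat_constant_metric Uo frame_first_form.
- exact: normals_basis.
- by move=> u Uu i al be; exact: frame_torsion.
Qed.

End ToSubmanifold.
End Frames.

(** The upper rows of the skew matrix contain only the second forms. Their symmetry therefore makes
    the tangent rows of a solution closed, as integrating them to an immersion requires. *)
Lemma block_skew_entry (R : comNzRingType) m n q (X Y : 'M[R]_(m, n))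
    (Z : 'M[R]_(m + n, q)) i j d :
  (forall al, X j al = Y i al) ->
  (block_mx 0 X (- X^T) 0 *m Z) (lshift n j) d =
  (block_mx 0 Y (- Y^T) 0 *m Z) (lshift n i) d.
Proof.
move=> XY; rewrite !mxE; apply: eq_bigr => y _; congr (_ * _).
case: (split_ordP y) => l ->; first by rewrite !block_mxEul !mxE.
by rewrite !block_mxEur.
Qed.

(** * Existence of adapted frames *)

Section SkewFrame.
Variables (R : realType) (N n : nat) (W : set 'rV[R]_N).
Notation V := 'rV[R]_N.
Variables (G H K : 'M[R]_n) (B : 'I_N -> V -> 'M[R]_n).
Hypothesis Wo : open W.
Hypothesis Hs : H^T = H.
Hypothesis HK : H *m K = 1%:M.
Hypothesis Bs : forall j u, (B j u)^T = - B j u.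
Hypothesis sB : forall j, smooth_on W (B j).
Hypothesis closed_B : forall u, W u -> forall i j,
  partial i (B j) u = partial j (B i) u.
Hypothesis comm_B : forall u, W u -> forall i j,
  (B i u *m H) *m (B j u *m H) = (B j u *m H) *m (B i u *m H).

(** The matrix equation decouples into one Pfaffian system per column, all with coefficients
    [B j *m H]. The Gram condition holds at [u0] by the choice of [F0] and propagates because [B] is
    skew. *)
Lemma skew_frame_exists (u0 : V) (F0 : 'M[R]_n) : W u0 ->
  F0 *m G *m F0^T = K ->
  exists U : set V, [/\ open U, U u0, U `<=` W,
    forall u (t : R), U u -> 0 <= t <= 1 -> U (t *: (u - u0) + u0) &
    exists F : V -> 'M[R]_n,
      [/\ smooth_on U F, forall u, U u -> F u *m G *m (F u)^T = K &
          forall u, U u -> forall j, partial j F u = B j u *m H *m F u]].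
Proof.
move=> Wu0 F0G.
have sOm j : smooth_on W (fun u => B j u *m H).
  exact (smooth_on_mulmx Wo (sB j) (@smooth_on_cst _ _ W _ H)).
have sOm' j x y : smooth_on W (fun u => (B j u *m H) x y).
  exact (proj1 (smooth_on_mxP Wo _) (sOm j) x y).
have cOm u : W u -> forall i j x y,
    partial i (fun v => (B j v *m H) x y) u =
    partial j (fun v => (B i v *m H) x y) u.
  move=> Wu i j x y.
  have E l m : partial l (fun v => (B m v *m H) x y) u =
      (partial l (B m) u *m H) x y.
    refine (eq_trans (esym (partial_mx l x y (smooth_on_exist (sOm m)) Wu)) _).
    exact (f_equal (fun X : 'M[R]_n => X x y)
      (partial_mulmx_cst Wo H l (sB m) Wu)).
  refine (eq_trans (E i j) (eq_trans _ (esym (E j i)))).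
  exact (f_equal (fun X : 'M[R]_n => (X *m H) x y) (closed_B Wu i j)).
have [U [Uo Uu0 UW Us sol]] := pfaffian_local Wo Wu0 sOm' cOm comm_B.
exists U; split; [exact: Uo|exact: Uu0|exact: UW|exact: Us|].
have /choice[Y YP] (d : 'I_(n)) := sol (fun x => F0 x d).
pose F u : 'M[R]_(n) := \matrix_(x, d) Y d x u.
have sF : smooth_on U F.
  apply/(smooth_on_mxP Uo) => x d.
  by under eq_fun do rewrite mxE; have [+ _ _] := YP d; exact.
have dF u : U u -> forall j, partial j F u = B j u *m H *m F u.
  move=> Uu j; apply/matrixP => x d.
  refine (eq_trans (partial_mx j x d (smooth_on_exist sF) Uu) _).
  under eq_fun do rewrite mxE.
  have [_ _ /(_ u Uu j x)] := YP d; move=> E; refine (eq_trans E _).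
  by rewrite mxE /pfaff; apply: eq_bigr => y _; rewrite [F u y d]mxE.
have Fu0 : F u0 = F0.
  by apply/matrixP => x d; rewrite mxE; have [_ -> _] := YP d.
exists F; split; [exact: sF| |exact: dF].
apply: (frame_gram_constant Uo Hs HK Bs sF dF Uu0 Us).
by rewrite Fu0.
Qed.

End SkewFrame.

(** * The submanifold prescribed by a potential *)

Section Main.
Variables (R : realType) (N k p : nat) (hN : (0 < N)%N) (hk : (0 < k)%N).
Notation L := (k * N + p)%N.
Notation V := 'rV[R]_N.
Variables (eta : 'M[R]_N) (c : 'M[R]_k) (mu : 'M[R]_L).
Hypotheses (heta : nondegenerate_symmetric eta)
  (hmu : nondegenerate_symmetric mu).
Variables (G : 'M[R]_(N + L)) (Phi : V -> R) (W : set V).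
Hypotheses (hG : nondegenerate_symmetric G) (Wo : open W)
  (sPhi : smooth_on W Phi).

Let H := frame_form eta mu.
Let K := frame_gram eta mu.
Let B := frame_skew k p hN Phi.
Let w := second_coefs k p hN Phi.

Lemma frame_form_sym : H^T = H.
Proof.
by rewrite /H /frame_form tr_block_mx !trmx0; case: heta => ->; case: hmu => ->.
Qed.

Lemma frame_form_gram : H *m K = 1%:M.
Proof. by apply: form_mul_gram; [case: heta|case: hmu]. Qed.

Section OneSolution.
Variables (U : set V) (r : V -> 'rV[R]_(N + L)).
Variables (n : 'I_L -> V -> 'rV[R]_(N + L)).
Hypotheses (Uo : open U) (UW : U `<=` W)
  (P : prescribed_by_potential G eta mu Phi U r n).

Lemma prescribed_frame :
  [/\ smooth_on U r, smooth_on U (frame r n),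
      forall u, U u -> frame r n u *m G *m (frame r n u)^T = K &
      forall u, U u -> forall j,
        partial j (frame r n) u = B j u *m H *m frame r n u].
Proof.
have [[[sr _] _ _ [sn nb] tor] ff ng sf sf0] := P.
have Gs : G^T = G by case: hG.
have normal u : U u -> forall al i, dot G (n al u) (partial i r u) = 0.
  move=> Uu al i; have [_ /(_ (n al u))[+ _]] := nb u Uu; apply.
  by rewrite -[X in (X <= _)%MS](rowK (fun al => n al u)) row_sub.
(* The direction of differentiation [j] is the first lower index of the second form but the last one
   in [second_coef]; the symmetry of third derivatives reconciles them. *)
have sE u : U u -> forall al i j, second_form G r n al u j i = w j u i al.
  move=> Uu al i j; rewrite (second_coefsE hN).
  case: (ltnP al (k * N)) => lt; last first.
    by rewrite (second_coef_ge hN Phi i j lt) sf0.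
  rewrite (second_coef_lt hN Phi i j lt).
  have [s alE] := block_indexP hN lt.
  refine (eq_trans (f_equal (fun b => second_form G r n b u j i) alE) _).
  refine (eq_trans (sf u Uu s _ j i) _).
  exact (third_swap23 Wo sPhi _ j i (UW Uu)).
have FG := frame_gramE Gs ff ng normal.
have GW := gauss_weingarten Uo Gs sr sn ff normal sE tor.
split; [exact: sr|exact: (smooth_frame Uo sr sn)|exact: FG|].
move=> u Uu j.
(* Multiplying [partial j F] by [G *m F^T *m H *m F], which is the identity, lets the products
   computed in [GW] determine the derivative. *)
have Gi := gram_inverse frame_form_gram (FG u Uu).
by rewrite -[LHS]mulmx1 -Gi !mulmxA (GW u j Uu).
Qed.

End OneSolution.

Lemma prescribed_unique (u0 : V) (U : set V) : open U -> connected U -> U u0 ->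
  U `<=` W -> forall r r' n n',
  prescribed_by_potential G eta mu Phi U r n ->
  prescribed_by_potential G eta mu Phi U r' n' ->
  exists (A : 'M[R]_(N + L)) (x : 'rV[R]_(N + L)), linear_isometry G A /\
    forall u, U u -> r' u = r u *m A + x /\ forall al, n' al u = n al u *m A.
Proof.
move=> Uo Uc Uu0 UW r r' n n' P P'.
have [sr sF FG dF] := prescribed_frame Uo UW P.
have [sr' sF' FG' dF'] := prescribed_frame Uo UW P'.
have Bs j u : (B j u)^T = - B j u by exact: frame_skew_tr.
have [A AG FA] := frame_rigidity Uo frame_form_sym frame_form_gram Bs sF dF
  Uc Uu0 sF' dF' FG FG'.
(* The translation is forced at [u0]; it is right everywhere because the tangent rows of [r'] and of
   [r *m A] agree. *)
exists A, (r' u0 - r u0 *m A); split.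
  by move=> x y; rewrite /dot trmx_mul !mulmxA -(mulmxA x) -(mulmxA x) AG.
have rowA u a : U u -> row a (frame r' n' u) = row a (frame r n u) *m A.
  by move=> Uu; rewrite FA // row_mul.
move=> u Uu; split; last first.
  by move=> al; have := rowA u (rshift N al) Uu; rewrite !frame_rowr.
have srA := smooth_on_mulmx Uo sr (@smooth_on_cst _ _ U _ A).
have sN := smooth_on_oppmx Uo srA.
pose f v := r' v - r v *m A.
have sf : smooth_on U f.
  by apply/smooth_onP => m; apply: (ck_onD Uo); apply/smooth_onP: m.
have df v : U v -> forall i, partial i f v = 0.
  move=> Uv i; refine (eq_trans (partialD i (smooth_on_exist sr')
    (smooth_on_exist sN) Uv) _).
  refine (eq_trans (f_equal (fun x => _ + x) (partial_oppmx i srA Uv)) _).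
  refine (eq_trans (f_equal (fun x => _ - x)
    (partial_mulmx_cst Uo A i sr Uv)) _).
  by have := rowA v (lshift L i) Uv; rewrite !frame_rowl => ->; rewrite subrr.
have := connected_constant Uo Uc Uu0 sf df Uu.
by rewrite /f => <-; rewrite addrCA subrr addr0.
Qed.

Hypothesis hblock : forall (s t : 'I_k) (m n : 'I_N),
  mu (block_index p s m) (block_index p t n) = c s t * eta m n.
Hypothesis hassoc : associativity_on eta W Phi.
Variables (a b a' b' : nat).
Hypotheses (hsig_eta : has_signature (invmx eta) a b)
  (hsig_mu : has_signature (invmx mu) a' b')
  (hsig_G : has_signature G (a + a') (b + b')).

(** The signatures of [invmx eta] and [invmx mu] add up to that of [K], so [G] and [K] are
    congruent, and a congruence matrix is the initial frame. *)
Lemma frame_exists (u0 : V) : W u0 ->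
  exists U : set V, [/\ open U, U u0, U `<=` W,
    forall u (t : R), U u -> 0 <= t <= 1 -> U (t *: (u - u0) + u0) &
    exists F : V -> 'M[R]_(N + L),
      [/\ smooth_on U F, forall u, U u -> F u *m G *m (F u)^T = K &
          forall u, U u -> forall j, partial j F u = B j u *m H *m F u]].
Proof.
move=> Wu0.
have Ku : K \in unitmx by have /mulmx1_unit[] := frame_form_gram.
have [F0 F0G] := congruent_of_signature (proj2 hG) Ku hsig_G
  (has_signature_block hsig_eta hsig_mu).
have Bs j u : (B j u)^T = - B j u by exact: frame_skew_tr.
have sB := smooth_frame_skew k p hN Wo sPhi.
have cB u (Wu : W u) i j := partial_frame_skew k p hN Wo sPhi i j Wu.
have mB u (Wu : W u) i j := frame_skew_comm hN Wo sPhi hk hblock hassoc i j Wu.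
exact (@skew_frame_exists R N (N + L) W G H K B Wo frame_form_sym
  frame_form_gram Bs sB cB mB u0 F0 Wu0 F0G).
Qed.

Lemma prescribed_exists (u0 : V) : W u0 ->
  exists U : set V, [/\ open U, U u0, U `<=` W &
    exists r n, prescribed_by_potential G eta mu Phi U r n].
Proof.
move=> Wu0; have [U [Uo Uu0 UW Us [F [sF FG dF]]]] := frame_exists Wu0.
exists U; split=> //.
have /(smooth_on_mxP Uo) sF' := sF.
have wC u i j al : U u -> w i u j al = w j u i al.
  move=> Uu; refine (eq_trans (second_coefsE _ _ _ _ _ _) _).
  refine (eq_trans _ (esym (second_coefsE _ _ _ _ _ _))).
  exact (second_coefC hN Wo sPhi al j i (UW u Uu)).
(* The ambient coordinates of the immersion are integrated one at a time from the tangent rows, on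
   the star-shaped set where the frame lives. *)
have /choice[rho rhoP] (d : 'I_(N + L)) : exists f : V -> R,
    [/\ smooth_on U f, f u0 = 0 &
      forall u, U u -> forall i, partial i f u = F u (lshift L i) d].
  apply: (poincare Uo Us _ _ Uu0) => [i|u Uu i j]; first exact: sF'.
  have E x y : partial x (fun v => F v (lshift L y) d) u =
      (B x u *m (H *m F u)) (lshift L y) d.
    refine (eq_trans (esym (partial_mx x _ d (smooth_on_exist sF) Uu)) _).
    rewrite mulmxA.
    exact (f_equal (fun X : 'M[R]_(N + L) => X _ d) (dF u Uu x)).
  refine (eq_trans (E i j) (eq_trans _ (esym (E j i)))).
  by apply: block_skew_entry => al; exact: wC.
pose r u : 'rV[R]_(N + L) := \row_d rho d u.
have sr : smooth_on U r.
  apply/(smooth_on_mxP Uo) => x d.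
  by under eq_fun do rewrite mxE; have [+ _ _] := rhoP d; exact.
have dr u : U u -> forall i, partial i r u = row (lshift L i) (F u).
  move=> Uu i; apply/rowP => d.
  refine (eq_trans (partial_mx i 0 d (smooth_on_exist sr) Uu) _).
  under eq_fun do rewrite mxE.
  have [_ _ /(_ u Uu i)] := rhoP d; move=> E; refine (eq_trans E _).
  by rewrite mxE.
have dFG u : U u -> forall j, partial j F u *m G *m (F u)^T =
    block_mx 0 (w j u) (- (w j u)^T) 0.
  move=> Uu j; rewrite dF // -!mulmxA (mulmxA (F u)) FG //.
  by rewrite frame_form_gram mulmx1.
have Finv u : U u -> exists X, F u *m X = 1%:M /\ X *m F u = 1%:M.
  move=> Uu; exists (G *m (F u)^T *m H).
  have Gi := gram_inverse frame_form_gram (FG u Uu).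
  by split=> //; exact: mulmx1C.
have Eu : invmx eta \in unitmx by rewrite unitmx_inv; case: heta.
have sE := frame_second_form Uo sF dr dFG.
exists r, (normals F); split.
- exact (submanifold_of_frame Uo Eu sr sF dr FG dFG Finv).
- exact: frame_first_form dr FG.
- exact: frame_normal_gram FG.
- move=> u Uu s m i j; refine (eq_trans (sE u _ i j Uu) _).
  refine (eq_trans (wC u i j _ Uu) _).
  exact: structure_mx_block.
- move=> u Uu al ge i j; refine (eq_trans (sE u _ i j Uu) _).
  exact: structure_mx_ge.
Qed.

End Main.
Theorem mainTheorem5 (R : realType) (N k p : nat)
    (hN : (0 < N)%N) (hk : (0 < k)%N)
    (eta : 'M[R]_N) (c : 'M[R]_k) (mu : 'M[R]_(k * N + p))
    (heta : nondegenerate_symmetric eta)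
    (hc : nondegenerate_symmetric c)
    (hmu : nondegenerate_symmetric mu)
    (hblock : forall (s t : 'I_k) (m n : 'I_N),
      mu (block_index p s m) (block_index p t n) = c s t * eta m n)
    (G : 'M[R]_(N + (k * N + p)))
    (hG : nondegenerate_symmetric G)
    (a b a' b' : nat)
    (hsig_eta : has_signature (invmx eta) a b)
    (hsig_mu : has_signature (invmx mu) a' b')
    (hsig_G : has_signature G (a + a') (b + b'))
    (u0 : 'rV[R]_N) (W : set 'rV[R]_N) (hW : open W) (hu0 : W u0)
    (Phi : 'rV[R]_N -> R)
    (hPhi : smooth_on W Phi)
    (hassoc : associativity_on eta W Phi) :
  (exists U : set 'rV[R]_N, [/\ open U, U u0, U `<=` W &
     exists (r : 'rV[R]_N -> 'rV[R]_(N + (k * N + p)))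
            (n : 'I_(k * N + p) -> 'rV[R]_N -> 'rV[R]_(N + (k * N + p))),
       prescribed_by_potential G eta mu Phi U r n])
  /\
  (forall U : set 'rV[R]_N, open U -> connected U -> U u0 -> U `<=` W ->
   forall (r r' : 'rV[R]_N -> 'rV[R]_(N + (k * N + p)))
          (n n' : 'I_(k * N + p) -> 'rV[R]_N -> 'rV[R]_(N + (k * N + p))),
     prescribed_by_potential G eta mu Phi U r n ->
     prescribed_by_potential G eta mu Phi U r' n' ->
     exists (A : 'M[R]_(N + (k * N + p))) (x : 'rV[R]_(N + (k * N + p))),
       linear_isometry G A /\
       forall u, U u ->
         r' u = r u *m A + x /\ forall al, n' al u = n al u *m A).
Proof.
split; last first.
  move=> U Uo Uc Uu0 UW r r' n n' P P'.
  exact (prescribed_unique hN heta hmu hG hW hPhi Uo Uc Uu0 UW P P').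
exact (prescribed_exists hN hk heta hmu hG hW hPhi hblock hassoc
  hsig_eta hsig_mu hsig_G hu0).
Qed.
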